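(* Let $\mathcal{M} \models \mathrm{KP}^\mathcal{P} + \Sigma_2^\mathcal{P}\text{-Separation} + \Pi_2^\mathcal{P}\text{-Foundation}$ be countable and non-standard. Let $\mathcal{S}$ be a rank-cut of $\mathcal{M}$. For any $\alpha \in \mathrm{Ord}^\mathcal{M}$, there is a rank-cut $i : \mathcal{M} \rightarrow \mathcal{M}$ (that is, a topless rank-initial self-embedding), fixing $\mathcal{S}$ pointwise, such that $\mathcal{M}_\alpha \subseteq i(\mathcal{M})$ and such that for every $\xi \in \mathrm{Ord}^\mathcal{M} \setminus \mathcal{S}$ there is $m \in \mathcal{M}$ with $\mathrm{rank}^\mathcal{M}(m) = \xi$ and $i(m) \neq m$.
   Context: $\mathcal{L}^0$ is the first-order language of set theory, with the binary symbol $\in$. Takahashi hierarchy: $\Delta_0^\mathcal{P}=\Sigma_0^\mathcal{P}=\Pi_0^\mathcal{P}$ is the set of $\mathcal{L}^0$-formulae all of whose quantifiers are of the forms $\exists x\in y$, $\forall x\in y$, $\exists x\subseteq y$, $\forall x\subseteq y$; $\Sigma_{n+1}^\mathcal{P}$ consists of formulae $\exists x\,\phi$ with $\phi\in\Pi_n^\mathcal{P}$, and $\Pi_{n+1}^\mathcal{P}$ of formulae $\forall x\,\phi$ with $\phi\in\Sigma_n^\mathcal{P}$ (all up to provable equivalence in $\mathrm{KP}^\mathcal{P}$). $\mathrm{KP}^\mathcal{P}$ has the axioms Extensionality, Pair, Union, Powerset, Infinity, and the schemata (with parameters) $\Delta_0^\mathcal{P}$-Separation, $\Delta_0^\mathcal{P}$-Collection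 ($\forall x(\forall u\in x\,\exists v\,\phi(u,v)\to\exists y\,\forall u\in x\,\exists v\in y\,\phi(u,v))$), and $\Pi_1^\mathcal{P}$-Foundation. $\Gamma$-Separation is the Separation schema for formulae in $\Gamma$, and $\Gamma$-Foundation is the schema $\exists x\,\phi(x)\to\exists y(\phi(y)\wedge\forall v\in y\,\neg\phi(v))$ for $\phi\in\Gamma$. A model is non-standard if its interpretation of $\in$ is not well-founded. $\mathrm{Ord}^\mathcal{N}$ is the class of ordinals of $\mathcal{N}$, and $\mathcal{N}_\alpha=\{n\in\mathcal{N}\mid\mathcal{N}\models\mathrm{rank}(n)<\alpha\}$. An embedding $i:\mathcal{M}\to\mathcal{N}$ is an injection with $\mathcal{M}\models x\in y\Leftrightarrow\mathcal{N}\models i(x)\in i(y)$. It is rank-initial if whenever $m\in\mathcal{M}$, $n\in\mathcal{N}$ and $\mathcal{N}\models\mathrm{rank}(n)\le\mathrm{rank}(i(m))$, then $n\in i(\mathcal{M})$. It is bounded if $i(\mathcal{M})\subseteq\mathcal{N}_\gamma$ for some $\gamma\in\mathrm{Ord}^\mathcal{N}$; it is topless if it is bounded and for every $\gamma\in\mathrm{Ord}^\mathcal{N}\setminus i(\mathcal{M})$ there is $\gamma'\in\mathrm{Ord}^\mathcal{N}\setminus i(\mathcal{M})$ with $\gamma'<^\mathcal{N}\gamma$. A rank-cut is a topless rank-initial embedding. A substructure $\mathcal{S}$ of $\mathcal{M}$ is a rank-cut of $\mathcal{M}$ if its inclusion map into $\mathcal{M}$ is rank-initial and topless. *)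

(* Defs.v *)
From Stdlib Require List.
From mathcomp Require Import all_boot.
From mathcomp Require Import boolp classical_sets functions cardinality.
Set Implicit Arguments.
Unset Strict Implicit.
Unset Printing Implicit Defensive.
Local Open Scope classical_set_scope.

(* Formulae of the language of set theory, with de Bruijn indices.  The
   language has no function symbols, so that terms are variables and
   substitutions are renamings of variables. *)
Inductive form : Type :=
| fBot
| fEq of nat & nat
| fMem of nat & nat
| fAnd of form & form
| fOr of form & form
| fImp of form & form
| fAll of form
| fEx of form.

Definition fNot (p : form) := fImp p fBot.
Definition fIff (p q : form) := fAnd (fImp p q) (fImp q p).

Definition scons (A : Type) (a : A) (e : nat -> A) (n : nat) : A :=
  if n is k.+1 then e k else a.

Definition up (r : nat -> nat) : nat -> nat := scons 0 (succn \o r).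

Fixpoint ren (r : nat -> nat) (p : form) : form :=
  match p with
  | fBot => fBot
  | fEq x y => fEq (r x) (r y)
  | fMem x y => fMem (r x) (r y)
  | fAnd p q => fAnd (ren r p) (ren r q)
  | fOr p q => fOr (ren r p) (ren r q)
  | fImp p q => fImp (ren r p) (ren r q)
  | fAll p => fAll (ren (up r) p)
  | fEx p => fEx (ren (up r) p)
  end.

Definition shift : form -> form := ren succn.
Definition inst (x : nat) : form -> form := ren (scons x id).

Definition fSub (x y : nat) := fAll (fImp (fMem 0 x.+1) (fMem 0 y.+1)).

(* Classical natural deduction with equality.  The formulae of [T] may have
   free variables and stand for their universal closures, which is why the
   rules [prv_allI] and [prv_exE] shift the local context but not [T]. *)
Inductive prv (T : set form) : seq form -> form -> Prop :=
| prv_ax G p : T p -> prv T G p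
| prv_hyp G p : List.In p G -> prv T G p
| prv_raa G p : prv T (fNot p :: G) fBot -> prv T G p
| prv_andI G p q : prv T G p -> prv T G q -> prv T G (fAnd p q)
| prv_andEl G p q : prv T G (fAnd p q) -> prv T G p
| prv_andEr G p q : prv T G (fAnd p q) -> prv T G q
| prv_orIl G p q : prv T G p -> prv T G (fOr p q)
| prv_orIr G p q : prv T G q -> prv T G (fOr p q)
| prv_orE G p q r :
    prv T G (fOr p q) -> prv T (p :: G) r -> prv T (q :: G) r -> prv T G r
| prv_impI G p q : prv T (p :: G) q -> prv T G (fImp p q)
| prv_impE G p q : prv T G (fImp p q) -> prv T G p -> prv T G q
| prv_allI G p : prv T (map shift G) p -> prv T G (fAll p)
| prv_allE G p x : prv T G (fAll p) -> prv T G (inst x p)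
| prv_exI G p x : prv T G (inst x p) -> prv T G (fEx p)
| prv_exE G p q :
    prv T G (fEx p) -> prv T (p :: map shift G) (shift q) -> prv T G q
| prv_eqI G x : prv T G (fEq x x)
| prv_eqE G p x y :
    prv T G (fEq x y) -> prv T G (inst x p) -> prv T G (inst y p).

(* [SigmaP] and [PiP] below form the Takahashi hierarchy.  In a bounded
   quantifier the bound [y.+1] is the variable [y] of the outer context, hence
   is distinct from the quantified variable 0. *)
Inductive Delta0P : set form :=
| D0_bot : Delta0P fBot
| D0_eq x y : Delta0P (fEq x y)
| D0_mem x y : Delta0P (fMem x y)
| D0_and p q : Delta0P p -> Delta0P q -> Delta0P (fAnd p q)
| D0_or p q : Delta0P p -> Delta0P q -> Delta0P (fOr p q)
| D0_imp p q : Delta0P p -> Delta0P q -> Delta0P (fImp p q)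
| D0_all_mem y p : Delta0P p -> Delta0P (fAll (fImp (fMem 0 y.+1) p))
| D0_ex_mem y p : Delta0P p -> Delta0P (fEx (fAnd (fMem 0 y.+1) p))
| D0_all_sub y p : Delta0P p -> Delta0P (fAll (fImp (fSub 0 y.+1) p))
| D0_ex_sub y p : Delta0P p -> Delta0P (fEx (fAnd (fSub 0 y.+1) p)).

Inductive SigmaP : nat -> set form :=
| Sigma0 p : Delta0P p -> SigmaP 0 p
| SigmaS n p : PiP n p -> SigmaP n.+1 (fEx p)
with PiP : nat -> set form :=
| Pi0 p : Delta0P p -> PiP 0 p
| PiS n p : SigmaP n p -> PiP n.+1 (fAll p).

Definition ax_ext : form :=
  fAll (fAll (fImp (fAll (fIff (fMem 0 2) (fMem 0 1))) (fEq 1 0))).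

Definition ax_pair : form :=
  fAll (fAll (fEx (fAll (fIff (fMem 0 1) (fOr (fEq 0 3) (fEq 0 2)))))).

Definition ax_union : form :=
  fAll (fEx (fAll (fIff (fMem 0 1) (fEx (fAnd (fMem 0 3) (fMem 1 0)))))).

Definition ax_power : form :=
  fAll (fEx (fAll (fIff (fMem 0 1) (fSub 0 2)))).

(* There is an x such that some empty y belongs to x, and for each y in x
   some z, whose elements are those of y and y itself, belongs to x. *)
Definition ax_inf : form :=
  fEx (fAnd (fEx (fAnd (fMem 0 1) (fAll (fNot (fMem 0 1)))))
            (fAll (fImp (fMem 0 1)
              (fEx (fAnd (fMem 0 2)
                 (fAll (fIff (fMem 0 1) (fOr (fMem 0 2) (fEq 0 2))))))))).

(* In the schemata the distinguished variables of [p] are 0 (and 1 for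
   Collection); its other free variables are parameters, and the renamings
   keep them apart from the variables quantified by the axiom. *)

(* forall x, exists y, forall z, z \in y <-> z \in x /\ p(z) *)
Definition ax_sep (p : form) : form :=
  fAll (fEx (fAll (fIff (fMem 0 1) (fAnd (fMem 0 2) (ren (up (addn 2)) p))))).

(* With p = p(u, v), u being 1 and v being 0:
   forall x, (forall u \in x, exists v, p(u, v)) ->
     exists y, forall u \in x, exists v \in y, p(u, v) *)
Definition ax_coll (p : form) : form :=
  fAll (fImp
    (fAll (fImp (fMem 0 1) (fEx (ren (up (up (addn 1))) p))))
    (fEx (fAll (fImp (fMem 0 2)
       (fEx (fAnd (fMem 0 2) (ren (up (up (addn 2))) p))))))).

(* (exists x, p(x)) -> exists y, p(y) /\ forall v \in y, ~ p(v) *)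
Definition ax_found (p : form) : form :=
  fImp (fEx p)
       (fEx (fAnd p (fAll (fImp (fMem 0 1) (fNot (ren (up (addn 1)) p)))))).

Definition KPP : set form :=
  [set ax_ext] `|` [set ax_pair] `|` [set ax_union] `|` [set ax_power]
  `|` [set ax_inf] `|` ax_sep @` Delta0P `|` ax_coll @` Delta0P
  `|` ax_found @` PiP 1.

(* Closure of a class of formulae under KP^P-provable equivalence. *)
Definition upto_KPP (C : set form) : set form :=
  [set p | exists2 q, C q & prv KPP [::] (fIff p q)].

Definition separation (C : set form) : set form := ax_sep @` upto_KPP C.
Definition foundation (C : set form) : set form := ax_found @` upto_KPP C.

Record structure : Type := Structure {
  carrier :> Type;
  elt : carrier -> carrier -> Prop
}.

Fixpoint sat (M : structure) (e : nat -> M) (p : form) : Prop :=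
  match p with
  | fBot => False
  | fEq x y => e x = e y
  | fMem x y => elt (e x) (e y)
  | fAnd p q => sat e p /\ sat e q
  | fOr p q => sat e p \/ sat e q
  | fImp p q => sat e p -> sat e q
  | fAll p => forall m : M, sat (scons m e) p
  | fEx p => exists m : M, sat (scons m e) p
  end.

Definition models (M : structure) (T : set form) : Prop :=
  forall p, T p -> forall e : nat -> M, sat e p.

Definition nonstandard (M : structure) : Prop := ~ well_founded (@elt M).

(* The notions below are the interpretations in [M] of the usual
   set-theoretic formulae: all quantifiers range over [M]. *)
Section Internal.
Variable M : structure.
Implicit Types x y z a b c p f : M.

Definition transitive_set x := forall y z, elt z y -> elt y x -> elt z x.

Definition Ord : set M :=
  [set x | transitive_set x /\ forall y, elt y x -> transitive_set y].

Definition is_upair z a b := forall c, elt c z <-> c = a \/ c = b.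

(* p is the Kuratowski pair {{a}, {a, b}} *)
Definition is_opair p a b :=
  forall z, elt z p <-> is_upair z a a \/ is_upair z a b.

Definition maps f x a := exists2 p, elt p f & is_opair p x a.

Definition is_function f :=
  (forall p, elt p f -> exists x a, is_opair p x a) /\
  (forall x a b, maps f x a -> maps f x b -> a = b).

(* f is a function with transitive domain satisfying the recursion equation
   f(x) = sup {f(y) + 1 | y \in x} = \bigcup_(y \in x) (f(y) `|` {f(y)}) *)
Definition rank_function f :=
  is_function f /\
  forall x a, maps f x a ->
    (forall y, elt y x -> exists b, maps f y b) /\
    (forall c, elt c a <->
       exists y b, [/\ elt y x, maps f y b & elt c b \/ c = b]).

Definition is_rank x a := exists2 f, rank_function f & maps f x a.

Definition rank_lt_ord x a := exists2 b, is_rank x b & elt b a.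

Definition rank_le x y :=
  exists a b, [/\ is_rank x a, is_rank y b & elt a b \/ a = b].

Definition level a : set M := [set x | rank_lt_ord x a].

End Internal.

Section Embeddings.
Variables M N : structure.
Implicit Type i : M -> N.

Definition embedding i :=
  injective i /\ forall x y : M, elt x y <-> elt (i x) (i y).

Definition rank_initial i :=
  embedding i /\ forall (m : M) (n : N), rank_le n (i m) -> range i n.

Definition bounded i := exists2 g : N, Ord g & range i `<=` level g.

Definition topless i :=
  bounded i /\
  forall g : N, Ord g -> ~ range i g ->
    exists g' : N, [/\ Ord g', ~ range i g' & elt g' g].

Definition rank_cut i := rank_initial i /\ topless i.

End Embeddings.

Definition substructure (M : structure) (S : set M) : structure :=
  @Structure {x : M | S x} (fun x y => elt (proj1_sig x) (proj1_sig y)).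

Definition rank_cut_of (M : structure) (S : set M) : Prop :=
  @rank_cut (substructure S) M (@proj1_sig M S).

(* Main.v *)
Require Import Defs.
From mathcomp Require Import all_boot.
From mathcomp Require Import boolp classical_sets functions cardinality.
Set Implicit Arguments.
Unset Strict Implicit.
Unset Printing Implicit Defensive.
Local Open Scope classical_set_scope.

(** Since M is countable, the embedding is the union of an increasing chain of
    finite partial maps a_1 |-> b_1, ..., a_k |-> b_k; what has to be found is
    an invariant of such maps, expressible in M, which survives every extension
    that the construction asks for.  Write a and b for the codes of the tuples.

    Classically the invariant says that each Sigma_1^P formula true of a holds
    of b below a bound beta, and it is handled through partial truth
    definitions whose codes of formulae may be non-standard.  Codes of formulae
    are replaced here by Ehrenfeucht-Fraisse games.  A state (x, a) stands for
    the structure V_x with the tuple a distinguished; a move appends an element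
    of V_x to the tuple, forgets an entry, replaces x by the last entry, or
    observes something about the last two entries.  The type of level d of a
    state is the set [btype d (x, a)], defined by recursion on d from the types
    of levels m < d of the states one move away, and cut down to the elements
    of V_d.  The invariant [transfers d beta a b] is:

      for each ordinal x there is z < beta such that (x, a) and (z, b) have the
      same type of level d.

    Two things make it work.  First, the cut S is topless, so there are infinite
    descending sequences of ordinals outside S; these are the levels, and each
    stage of the construction spends a standard number of them.  Types of level
    d reveal the entries that belong to V_m for m well below d, hence those in
    S, which are therefore fixed by the embedding.  Secondly, Sigma_1-collection turns a choice that
    depends on x into a uniform one ([transfers_uniform]): if each element of a
    set of candidates failed at some x, all of them would fail before one larger
    x, at which one of them succeeds.  Every extension step is an instance:
    adding a_(k+1) to the domain ([forth], candidates in V_beta), adding to the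
    range an element of rank at most that of some b_j ([back], candidates of
    rank at most that of a_j), and lowering beta ([shrink], candidates the
    ordinals below beta).  The first beta exists because the types of level d
    form a set ([start]).

    Lowering beta makes the embedding topless: for an ordinal g, either the
    invariant holds with g in place of beta, and then with some g' < g, which
    bounds the range from then on; or it fails at some ordinal x, and then the
    image of x has rank at least g, so that g will be in the range
    ([dense_topless]).

    An element of each rank x0 outside S is moved by a cardinality argument
    ([same_types]).  Types of level d are subsets of V_d, so that for d well
    below x0 there are, by Cantor's theorem, two distinct elements u and w of
    rank x0 such that the same types of level d are realised by the tuples
    (a, u) and (a, w).  An image of w is then also an admissible image of u, and
    it differs from one of them.

    The rest develops set theory inside M: Sigma_1 and Delta_1 predicates with
    parameters are handled semantically, as predicates on assignments, and a
    syntax-directed tactic proves that a given predicate is one of them. *)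

(** * Renaming and the Takahashi hierarchy *)

Lemma sat_ren (M : structure) p r (e : nat -> M) :
  sat e (ren r p) <-> sat (e \o r) p.
Proof.
have upE s (m : M) f : scons m f \o up s = scons m (f \o s).
  by apply/funext => -[|n].
elim: p r e => //= [p IHp q IHq|p IHp q IHq|p IHp q IHq|p IHp|p IHp] r e.
- by rewrite IHp IHq.
- by rewrite IHp IHq.
- by rewrite IHp IHq.
- by split=> h m; move: (h m); rewrite IHp upE.
- by split=> -[m h]; exists m; move: h; rewrite IHp upE.
Qed.

Definition renamable (C : set form) := forall r p, C p -> C (ren r p).

Lemma renamable_Delta0P : renamable Delta0P.
Proof. by move=> r p h; elim: h r => /=; eauto using Delta0P. Qed.

Lemma renamable_SigmaP_PiP n : renamable (SigmaP n) /\ renamable (PiP n).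
Proof.
elim: n => [|n [IHS IHP]]; split=> r p h; inversion_clear h => /=; constructor.
- exact: renamable_Delta0P.
- exact: renamable_Delta0P.
- exact: IHP.
- exact: IHS.
Qed.

Lemma upto_KPP_refl (C : set form) p : C p -> upto_KPP C p.
Proof.
move=> Cp; exists p => //.
have pp : prv KPP [::] (fImp p p) by apply: prv_impI; apply: prv_hyp; left.
exact: prv_andI.
Qed.

(** * Definable predicates on assignments *)

Section Definability.
Variable M : structure.
Implicit Types (e : nat -> M) (P Q : (nat -> M) -> Prop).

Definition tval (t : nat + M) e : M :=
  match t with inl k => e k | inr c => c end.

(** An interpretation [r] sends each variable of a formula either to a position
    of the assignment or to a parameter in M, so that formulae with parameters
    can be combined freely. *)
Definition val (r : nat -> nat + M) e : nat -> M := fun n => tval (r n) e.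

Definition definable (C : set form) P :=
  exists p r, C p /\ forall e, sat (val r e) p <-> P e.

Lemma definable_ext C P Q :
  (forall e, P e <-> Q e) -> definable C P -> definable C Q.
Proof. by move=> h [p [r [Cp pP]]]; exists p, r; split=> // e; rewrite pP. Qed.

(** To quantify over position 0, the interpretation [r] of a formula is replaced
    by [lower r], which reads the assignment without that position, and the
    variables that [r] sends to position 0 are renamed to 0 by [under k r];
    the other ones are moved up by [k] to make room for the quantified variable
    and, when [k] is 2, for the bound of a bounded quantifier. *)
Definition lower (r : nat -> nat + M) n :=
  match r n with inl k.+1 => inl k | inl 0 => inl 0 | inr c => inr c end.
Definition under k (r : nat -> nat + M) n := if r n is inl 0 then 0 else n + k.

Lemma val_lower r e m (f : nat -> M) k :
  (forall n, f (n + k) = val (lower r) e n) -> f 0 = m ->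
  f \o under k r = val r (scons m e).
Proof.
move=> fk f0; apply/funext => n; rewrite /comp /under /val.
by move: (fk n); rewrite /val /lower; case: (r n) => [[|j]|c] //=.
Qed.

Lemma definable_quant (C : set form) P : renamable C -> definable C P ->
  exists p r, C p /\ forall e m, sat (scons m (val r e)) p <-> P (scons m e).
Proof.
move=> rC [p [r [Cp pP]]]; exists (ren (under 1 r) p), (lower r).
split=> [|e m]; first exact: rC.
rewrite sat_ren (@val_lower r e m) ?pP // => n; by rewrite addn1.
Qed.

Lemma definable_ex (C C' : set form) (Q : M -> (nat -> M) -> Prop) :
  renamable C -> (forall p, C p -> C' (fEx p)) ->
  definable C (fun e => Q (e 0) (fun n => e n.+1)) ->
  definable C' (fun e => exists m, Q m e).
Proof.
move=> rC CC' /(definable_quant rC)[p [r [Cp pP]]]; exists (fEx p), r.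
split=> [|e /=]; first exact: CC'.
have {}pP m : sat (scons m (val r e)) p <-> Q m e := pP e m.
by split=> -[m /pP h]; exists m.
Qed.

Lemma definable_all (C C' : set form) (Q : M -> (nat -> M) -> Prop) :
  renamable C -> (forall p, C p -> C' (fAll p)) ->
  definable C (fun e => Q (e 0) (fun n => e n.+1)) ->
  definable C' (fun e => forall m, Q m e).
Proof.
move=> rC CC' /(definable_quant rC)[p [r [Cp pP]]]; exists (fAll p), r.
split=> [|e /=]; first exact: CC'.
have {}pP m : sat (scons m (val r e)) p <-> Q m e := pP e m.
by split=> h m; apply/pP.
Qed.

Notation D0 := (definable Delta0P).

(** Two predicates get a common interpretation of variables, the first using
    the even variables and the second the odd ones. *)
Lemma definable2 (C1 C2 : set form) P Q : renamable C1 -> renamable C2 ->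
  definable C1 P -> definable C2 Q ->
  exists p q r, [/\ C1 p, C2 q, (forall e, sat (val r e) p <-> P e) &
     forall e, sat (val r e) q <-> Q e].
Proof.
move=> rC1 rC2 [p [r [Cp pP]]] [q [s [Cq qQ]]].
pose t n := if odd n then s n./2 else r n./2.
exists (ren double p), (ren (succn \o double) q), t.
split; [exact: rC1|exact: rC2|move=> e|move=> e]; rewrite sat_ren.
- have -> : val t e \o double = val r e; last exact: pP.
  by apply/funext => n; rewrite /val /comp /t odd_double doubleK.
- have -> : val t e \o (succn \o double) = val s e; last exact: qQ.
  by apply/funext => n; rewrite /val /comp /t /= odd_double /= uphalf_double.
Qed.

Lemma D0_and P Q : D0 P -> D0 Q -> D0 (fun e => P e /\ Q e).
Proof.
move=> hP hQ; have r0 := renamable_Delta0P.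
have [p [q [r [Cp Cq pP qQ]]]] := definable2 r0 r0 hP hQ.
by exists (fAnd p q), r; split=> [|e /=]; [exact: D0_and|rewrite pP qQ].
Qed.

Lemma D0_or P Q : D0 P -> D0 Q -> D0 (fun e => P e \/ Q e).
Proof.
move=> hP hQ; have r0 := renamable_Delta0P.
have [p [q [r [Cp Cq pP qQ]]]] := definable2 r0 r0 hP hQ.
by exists (fOr p q), r; split=> [|e /=]; [exact: D0_or|rewrite pP qQ].
Qed.

Lemma D0_not P : D0 P -> D0 (fun e => ~ P e).
Proof.
move=> [p [r [Cp pP]]]; exists (fNot p), r; split=> [|e].
  by apply: D0_imp => //; exact: D0_bot.
by rewrite -pP.
Qed.

Lemma D0_imp P Q : D0 P -> D0 Q -> D0 (fun e => P e -> Q e).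
Proof.
move=> hP hQ; apply: definable_ext (D0_or (D0_not hP) hQ) => e.
by rewrite implyE.
Qed.

Definition term (t : (nat -> M) -> M) := exists s, forall e, t e = tval s e.

Lemma term_var n : term (fun e => e n). Proof. by exists (inl n). Qed.

Lemma D0_mem t u : term t -> term u -> D0 (fun e => elt (t e) (u e)).
Proof.
move=> [s st] [v vu]; exists (fMem 0 1), (scons s (fun=> v)).
by split=> [|e /=]; [exact: D0_mem|rewrite st vu].
Qed.

Lemma D0_eq t u : term t -> term u -> D0 (fun e => t e = u e).
Proof.
move=> [s st] [v vu]; exists (fEq 0 1), (scons s (fun=> v)).
by split=> [|e /=]; [exact: D0_eq|rewrite st vu].
Qed.

Lemma D0_bounded t (Q : M -> (nat -> M) -> Prop) : term t ->
  D0 (fun e => Q (e 0) (fun n => e n.+1)) ->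
  exists p r, [/\ Delta0P p, forall e, val r e 0 = t e &
    forall e m, sat (scons m (val r e)) p <-> Q m e].
Proof.
move=> [s st] [p [r [Cp pP]]].
exists (ren (under 2 r) p), (scons s (lower r)).
split=> [|e|e m]; [exact: renamable_Delta0P|by rewrite st|].
rewrite sat_ren (@val_lower r e m) ?pP // => n; by rewrite addn2.
Qed.

Lemma D0_ball t (Q : M -> (nat -> M) -> Prop) : term t ->
  D0 (fun e => Q (e 0) (fun n => e n.+1)) ->
  D0 (fun e => forall m, elt m (t e) -> Q m e).
Proof.
move=> ht hQ; have [p [r [Cp r0 pP]]] := D0_bounded ht hQ.
exists (fAll (fImp (fMem 0 1) p)), r; split=> [|e].
  exact: D0_all_mem.
by rewrite -r0; split=> /= h m /h /pP.
Qed.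

Lemma D0_bex t (Q : M -> (nat -> M) -> Prop) : term t ->
  D0 (fun e => Q (e 0) (fun n => e n.+1)) ->
  D0 (fun e => exists m, elt m (t e) /\ Q m e).
Proof.
move=> ht hQ; have [p [r [Cp r0 pP]]] := D0_bounded ht hQ.
exists (fEx (fAnd (fMem 0 1) p)), r; split=> [|e].
  exact: D0_ex_mem.
by rewrite -r0; split=> /= -[m [h /pP h']]; exists m.
Qed.

Lemma D0_ball_sub t (Q : M -> (nat -> M) -> Prop) : term t ->
  D0 (fun e => Q (e 0) (fun n => e n.+1)) ->
  D0 (fun e => forall m, (forall z, elt z m -> elt z (t e)) -> Q m e).
Proof.
move=> ht hQ; have [p [r [Cp r0 pP]]] := D0_bounded ht hQ.
exists (fAll (fImp (fSub 0 1) p)), r; split=> [|e].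
  exact: D0_all_sub.
by rewrite -r0; split=> /= h m /h /pP.
Qed.

Lemma definable_subst C P (f : nat -> nat + M) :
  definable C P -> definable C (fun e => P (val f e)).
Proof.
move=> [p [r [Cp pP]]].
exists p, (fun n => match r n with inl k => f k | inr c => inr c end).
split=> // e; rewrite -pP; suff -> : val r (val f e) =
  val (fun n => match r n with inl k => f k | inr c => inr c end) e by [].
by apply/funext => n; rewrite /val; case: (r n).
Qed.

(** Sigma_1 and Sigma_2 predicates, with parameters, in the sense of the
    Takahashi hierarchy. *)
Definition S1 P := exists2 Q, D0 Q & forall e, P e <-> exists m, Q (scons m e).
Definition S2 P :=
  exists2 Q, S1 Q & forall e, P e <-> exists m, ~ Q (scons m e).

Lemma S1_ext P Q : (forall e, P e <-> Q e) -> S1 P -> S1 Q.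
Proof. by move=> h [R hR RP]; exists R => // e; rewrite -h RP. Qed.

Lemma S1_D0 P : D0 P -> S1 P.
Proof.
move=> hP; exists (fun e => P (fun n => e n.+1)); last first.
  by move=> e; split=> [h|[//]]; exists (e 0).
exact: (definable_subst (fun n => inl n.+1) hP).
Qed.

Lemma S1_or P Q : S1 P -> S1 Q -> S1 (fun e => P e \/ Q e).
Proof.
move=> [P' hP' PP'] [Q' hQ' QQ'].
exists (fun e => P' e \/ Q' e); first exact: D0_or.
move=> e; rewrite PP' QQ'; split=> [[[m h]|[m h]]|[m [h|h]]].
- by exists m; left.
- by exists m; right.
- by left; exists m.
- by right; exists m.
Qed.

Lemma S1_subst P (f : nat -> nat + M) : S1 P -> S1 (fun e => P (val f e)).
Proof.
move=> [Q hQ PQ].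
pose g n := if n is k.+1 then
  match f k with inl j => inl j.+1 | inr c => inr c end else inl 0.
exists (fun e => Q (val g e)); first exact: definable_subst.
move=> e; rewrite PQ; suff h m : val g (scons m e) = scons m (val f e).
  by split=> -[m hm]; exists m; move: hm; rewrite h.
by apply/funext => -[|n] //; rewrite /val /=; case: (f n).
Qed.

Lemma S2_S1 P : S1 P -> S2 P.
Proof.
move=> [Q hQ PQ]; exists (fun e => ~ Q e); first exact/S1_D0/D0_not.
by move=> e; rewrite PQ; split=> -[m h]; exists m => //; apply: contrapT.
Qed.

Lemma S2_P1 P : S1 (fun e => ~ P e) -> S2 P.
Proof.
move=> hP; exists (fun e => ~ P (fun n => e n.+1)).
  exact: (S1_subst (fun n => inl n.+1) hP).
move=> e; split=> [h|[m]]; last exact: contrapT.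
by exists (e 0) => /(_ h).
Qed.

Lemma scons_eta e : scons (e 0) (fun n => e n.+1) = e.
Proof. by apply/funext => -[|]. Qed.

Lemma S2_definable P : S2 P -> definable (SigmaP 2) P.
Proof.
move=> [Q [R hR QR] PQ].
apply: (@definable_ext _
  (fun e => exists m, forall m', ~ R (scons m' (scons m e)))).
  by move=> e; rewrite PQ; split=> -[m h]; exists m; move: h;
    rewrite QR -forallNP.
apply: (definable_ex (renamable_SigmaP_PiP 1).2) => [p hp|].
  by constructor.
apply: (definable_all renamable_Delta0P) => [p hp|].
  by do 2 constructor.
apply: D0_not; apply: definable_ext hR => e.
by rewrite /= (scons_eta (fun n => e n.+1)) scons_eta.
Qed.

Lemma S2_definable_not P : S2 P -> definable (PiP 2) (fun e => ~ P e).
Proof.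
move=> [Q [R hR QR] PQ].
apply: (@definable_ext _
  (fun e => forall m, exists m', R (scons m' (scons m e)))).
  move=> e; rewrite PQ; split=> [h [m]|h m]; first by rewrite QR.
  by rewrite -QR; apply: contrapT => h'; apply: h; exists m.
apply: (definable_all (renamable_SigmaP_PiP 1).1) => [p hp|].
  by constructor.
apply: (definable_ex renamable_Delta0P) => [p hp|].
  by do 2 constructor.
apply: definable_ext hR => e.
by rewrite /= (scons_eta (fun n => e n.+1)) scons_eta.
Qed.

End Definability.

(** * Consequences of the axioms *)

Section SetTheory.
Variable M : structure.
Hypothesis hM : models M (KPP `|` separation (SigmaP 2) `|` foundation (PiP 2)).
Hypothesis inh : inhabited M.
Local Notation "x ∈ y" := (@elt M x y) (at level 70).
Notation D0 := (@definable M Delta0P).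
Notation S1 := (@S1 M).
Notation S2 := (@S2 M).
Implicit Types (e : nat -> M) (P Q : (nat -> M) -> Prop) (x y z u v w : M).

Lemma satKPP p e : KPP p -> sat e p.
Proof. by move=> hp; apply: hM; left; left. Qed.

Lemma someM : exists e : nat -> M, True.
Proof. by case: inh => m; exists (fun=> m). Qed.

Lemma ext x y : (forall z, z ∈ x <-> z ∈ y) -> x = y.
Proof.
move=> h; have [e _] := someM.
by apply: (@satKPP ax_ext e) h; do 7 left.
Qed.

Lemma pairing x y : exists w, forall z, z ∈ w <-> z = x \/ z = y.
Proof.
have [e _] := someM.
have K : KPP ax_pair by do 6 left; right.
exact: (satKPP e K x y).
Qed.

Lemma unions x : exists w, forall z, z ∈ w <-> exists y, y ∈ x /\ z ∈ y.
Proof.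
have [e _] := someM.
have K : KPP ax_union by do 5 left; right.
exact: (satKPP e K x).
Qed.

Lemma powers x : exists w, forall z, z ∈ w <-> forall y, y ∈ z -> y ∈ x.
Proof.
have [e _] := someM.
have K : KPP ax_power by do 4 left; right.
exact: (satKPP e K x).
Qed.

Lemma separationS2 (P : M -> Prop) x : S2 (fun e => P (e 0)) ->
  exists w, forall z, z ∈ w <-> z ∈ x /\ P z.
Proof.
move=> /S2_definable/(definable_quant (renamable_SigmaP_PiP 2).1).
move=> [p [r [Cp pP]]]; have [e _] := someM.
have K : (KPP `|` separation (SigmaP 2) `|` foundation (PiP 2)) (ax_sep p).
  by left; right; exists p => //; exact: upto_KPP_refl.
have [y hy] := hM K (val r e) x.
exists y => z; have {}hy : z ∈ y <-> z ∈ x /\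
  sat (scons z (scons y (scons x (val r e)))) (ren (up (addn 2)) p) := hy z.
have {}pP : sat (scons z (val r e)) p <-> P z := pP e z.
rewrite hy sat_ren -pP.
suff -> : scons z (scons y (scons x (val r e))) \o up (addn 2) =
  scons z (val r e) by [].
by apply/funext => -[|n].
Qed.

Lemma inductionS2 (P : M -> Prop) : S2 (fun e => P (e 0)) ->
  (forall x, (forall y, y ∈ x -> P y) -> P x) -> forall x, P x.
Proof.
move=> /S2_definable_not/(definable_quant (renamable_SigmaP_PiP 2).2).
move=> [p [r [Cp pP]]] hP x; apply: contrapT => nPx.
have [e _] := someM.
have h : sat (val r e) (ax_found p).
  by apply: hM; right; exists p => //; exact: upto_KPP_refl.
case: h => [|y [/pP nPy hy]]; first by exists x; apply/pP.
apply: nPy; apply: hP => z zy.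
have : ~ sat (scons z (scons y (val r e))) (ren (up (addn 1)) p) := hy z zy.
rewrite sat_ren => nPz; apply: contrapT => /(pP e z); move: nPz.
suff -> : scons z (scons y (val r e)) \o up (addn 1) = scons z (val r e) by [].
by apply/funext => -[|n].
Qed.

Lemma collectionD0 Q e x : D0 Q ->
  (forall u, u ∈ x -> exists v, Q (scons v (scons u e))) ->
  exists y, forall u, u ∈ x -> exists v, v ∈ y /\ Q (scons v (scons u e)).
Proof.
move=> /(definable_quant renamable_Delta0P)[p [r [Cp pQ]]].
pose q := ren (up (under 1 r)) p.
have qQ u v : sat (scons v (scons u (val (lower r) e))) q <->
    Q (scons v (scons u e)).
  rewrite sat_ren -pQ -(@val_lower _ r e u (scons u (val (lower r) e)) 1) //.
    suff -> : scons v (scons u (val (lower r) e)) \o up (under 1 r) =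
      scons v (scons u (val (lower r) e) \o under 1 r) by [].
    by apply/funext => -[|n].
  by move=> n; rewrite addn1.
move=> h; have K : KPP (ax_coll q).
  by left; right; exists q => //; exact: renamable_Delta0P.
case: (satKPP (val (lower r) e) K x).
- move=> u /= /h[v hv]; exists v; apply/sat_ren.
  suff -> : scons v (scons u (scons x (val (lower r) e))) \o up (up (addn 1)) =
    scons v (scons u (val (lower r) e)) by apply/qQ.
  by apply/funext => -[|[|n]].
- move=> y hy; exists y => u uy; have [v [vy /sat_ren hv]] := hy u uy.
  exists v; split=> //; apply/qQ; move: hv.
  suff -> : scons v (scons u (scons y (scons x (val (lower r) e))))
    \o up (up (addn 2)) = scons v (scons u (val (lower r) e)) by [].
  by apply/funext => -[|[|n]].
Qed.

(** * Calculus of Sigma-one predicates and functions *)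

(** By pairing, two unbounded quantifiers reduce to one. *)
Lemma S1_ex2 Q : D0 Q ->
  S1 (fun e => exists m m', Q (scons m' (scons m e))).
Proof.
move=> hQ; exists (fun e => exists m, m ∈ e 0 /\ exists m', m' ∈ e 0 /\
    Q (scons m' (scons m (fun n => e n.+1)))).
  apply: D0_bex; first exact: term_var.
  apply: D0_bex; first exact: term_var.
  pose f n : nat + M :=
    if n is k.+1 then if k is j.+1 then inl j.+3 else inl 1 else inl 0.
  apply: definable_ext (definable_subst f hQ) => e.
  suff -> : val f e = scons (e 0) (scons (e 1) (fun n => e n.+3)) by [].
  by apply/funext => -[|[|n]].
move=> e; split=> [[m [m' h]]|[w [m [_ [m' [_ h]]]]]]; last by exists m, m'.
have [w hw] := pairing m m'; exists w, m; split; first by apply/hw; left.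
by exists m'; split=> //; apply/hw; right.
Qed.

Lemma S1_ex (Q : M -> (nat -> M) -> Prop) :
  S1 (fun e => Q (e 0) (fun n => e n.+1)) -> S1 (fun e => exists m, Q m e).
Proof.
move=> [R hR QR]; apply: S1_ext (S1_ex2 hR) => e.
by split=> -[m h]; exists m; apply/(QR (scons m e)).
Qed.

Lemma S1_and P Q : S1 P -> S1 Q -> S1 (fun e => P e /\ Q e).
Proof.
move=> [P' hP' PP'] [Q' hQ' QQ'].
have h : D0 (fun e => P' (fun n => if n is k.+1 then e k.+2 else e 0) /\
    Q' (fun n => e n.+1)).
  apply: D0_and.
    pose f n : nat + M := if n is k.+1 then inl k.+2 else inl 0.
    apply: definable_ext (definable_subst f hP') => e.
    suff -> : val f e = (fun n => if n is k.+1 then e k.+2 else e 0) by [].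
    by apply/funext => -[].
  exact: (definable_subst (fun n => inl n.+1) hQ').
apply: S1_ext (S1_ex2 h) => e; rewrite PP' QQ'.
split=> [[m [m' [h1 h2]]]|[[m' h1] [m h2]]]; last by exists m, m'.
by split; [exists m'|exists m].
Qed.

(** Collection bounds the witnesses, uniformly in the bounded variable. *)
Lemma S1_ball_term t (Q : M -> (nat -> M) -> Prop) : term t ->
  S1 (fun e => Q (e 0) (fun n => e n.+1)) ->
  S1 (fun e => forall m, m ∈ t e -> Q m e).
Proof.
move=> ht [R hR QR].
exists (fun e => forall m, m ∈ t (fun n => e n.+1) -> exists m', m' ∈ e 0 /\
    R (scons m' (scons m (fun n => e n.+1)))).
  apply: D0_ball.
    case: ht => -[k|c] tE; first by exists (inl k.+1) => e; rewrite tE.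
    by exists (inr c) => e; rewrite tE.
  apply: D0_bex; first exact: term_var.
  pose f n : nat + M :=
    if n is k.+1 then if k is j.+1 then inl j.+3 else inl 1 else inl 0.
  apply: definable_ext (definable_subst f hR) => e.
  suff -> : val f e = scons (e 0) (scons (e 1) (fun n => e n.+3)) by [].
  by apply/funext => -[|[|n]].
move=> e; split=> [h|[y h] m /h[m' [_ h']]].
  apply: (collectionD0 (e := e) (x := t e) hR) => m me.
  exact/(QR (scons m e))/h.
by apply/(QR (scons m e)); exists m'.
Qed.

(** [D1] are the Delta_1 predicates.  [T1] are the functions of the assignment
    with a Sigma_1 graph; they are total, so that their graph is Delta_1 and
    they may be substituted into Delta_1 predicates ([D1_app]). *)
Definition D1 P := S1 P /\ S1 (fun e => ~ P e).
Definition T1 (F : (nat -> M) -> M) := S1 (fun e => e 0 = F (fun n => e n.+1)).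

Lemma D1_D0 P : D0 P -> D1 P.
Proof. by move=> h; split; [exact: S1_D0|exact/S1_D0/D0_not]. Qed.

Lemma D1_const (p : Prop) : D1 (fun=> p).
Proof.
have h (q : Prop) : D0 (fun=> q).
  have [hq|hq] := pselect q.
    apply: definable_ext (D0_eq (term_var M 0) (term_var M 0)) => e; split=> //.
  apply: definable_ext (D0_not (D0_eq (term_var M 0) (term_var M 0))) => e.
  by split.
exact: D1_D0.
Qed.

Lemma T1_var n : T1 (fun e => e n).
Proof. exact: (S1_D0 (D0_eq (term_var M 0) (term_var M n.+1))). Qed.

Lemma T1_const x : T1 (fun=> x).
Proof. by apply/S1_D0/D0_eq; [exact: term_var|exists (inr x)]. Qed.

Lemma D1_ext P Q : (forall e, P e <-> Q e) -> D1 P -> D1 Q.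
Proof.
move=> h [h1 h2]; split; first exact: S1_ext h1.
by apply: S1_ext h2 => e; rewrite h.
Qed.

Lemma D1_not P : D1 P -> D1 (fun e => ~ P e).
Proof.
by move=> [h1 h2]; split=> //; apply: S1_ext h1 => e; rewrite notE.
Qed.

Lemma D1_and P Q : D1 P -> D1 Q -> D1 (fun e => P e /\ Q e).
Proof.
move=> [p1 p2] [q1 q2]; split; first exact: S1_and.
by apply: S1_ext (S1_or p2 q2) => e; rewrite not_andE.
Qed.

Lemma D1_or P Q : D1 P -> D1 Q -> D1 (fun e => P e \/ Q e).
Proof.
move=> [p1 p2] [q1 q2]; split; first exact: S1_or.
by apply: S1_ext (S1_and p2 q2) => e; rewrite not_orE.
Qed.

Lemma D1_imp P Q : D1 P -> D1 Q -> D1 (fun e => P e -> Q e).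
Proof.
by move=> hP hQ; apply: D1_ext (D1_or (D1_not hP) hQ) => e; rewrite implyE.
Qed.

Lemma D1_iff P Q : D1 P -> D1 Q -> D1 (fun e => P e <-> Q e).
Proof. by move=> hP hQ; apply: D1_and; exact: D1_imp. Qed.

Lemma S1_app F (Q : M -> (nat -> M) -> Prop) : T1 F ->
  S1 (fun e => Q (e 0) (fun n => e n.+1)) -> S1 (fun e => Q (F e) e).
Proof.
move=> hF hQ; apply: S1_ext (S1_ex (Q := fun m e => m = F e /\ Q m e) _).
  by move=> e; split=> [[m [->]]|h] //; exists (F e).
exact: S1_and hF hQ.
Qed.

Lemma D1_app F (Q : M -> (nat -> M) -> Prop) : T1 F ->
  D1 (fun e => Q (e 0) (fun n => e n.+1)) -> D1 (fun e => Q (F e) e).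
Proof.
move=> hF [h1 h2]; split; first exact: S1_app hF h1.
exact: (S1_app (Q := fun m e => ~ Q m e) hF h2).
Qed.

Lemma T1_tail F : T1 F -> T1 (fun e => F (fun n => e n.+1)).
Proof.
exact: (S1_subst (fun n => if n is k.+1 then inl k.+2 else inl 0)).
Qed.

Lemma D1_app2 F G (R : M -> M -> Prop) : T1 F -> T1 G ->
  D1 (fun e => R (e 0) (e 1)) -> D1 (fun e => R (F e) (G e)).
Proof.
move=> hF hG hR; apply: (D1_app (Q := fun x e => R x (G e)) hF).
apply: (D1_app (Q := fun y e => R (e 0) y)); first exact: T1_tail.
pose f n : nat + M := if n is 0 then inl 1 else inl 0.
by split; [exact: (S1_subst f hR.1)|exact: (S1_subst f hR.2)].
Qed.

Lemma S1_app2 F G (R : M -> M -> Prop) : T1 F -> T1 G ->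
  S1 (fun e => R (e 0) (e 1)) -> S1 (fun e => R (F e) (G e)).
Proof.
move=> hF hG hR; apply: (S1_app (Q := fun x e => R x (G e)) hF).
apply: (S1_app (Q := fun y e => R (e 0) y)); first exact: T1_tail.
exact: (S1_subst (fun n => if n is 0 then inl 1 else inl 0) hR).
Qed.

Lemma S1_app3 F G H (R : M -> M -> M -> Prop) : T1 F -> T1 G -> T1 H ->
  S1 (fun e => R (e 0) (e 1) (e 2)) -> S1 (fun e => R (F e) (G e) (H e)).
Proof.
move=> hF hG hH hR; apply: (S1_app (Q := fun x e => R x (G e) (H e)) hF).
apply: (S1_app (Q := fun y e => R (e 0) y (H (fun n => e n.+1)))).
  exact: T1_tail.
apply: (S1_app (Q := fun z e => R (e 1) (e 0) z)).
  exact/(T1_tail (T1_tail hH)).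
exact: (S1_subst (fun n => if n is 0 then inl 2 else
  if n is 1 then inl 1 else inl 0) hR).
Qed.

Lemma D1_app3 F G H (R : M -> M -> M -> Prop) : T1 F -> T1 G -> T1 H ->
  D1 (fun e => R (e 0) (e 1) (e 2)) -> D1 (fun e => R (F e) (G e) (H e)).
Proof.
move=> hF hG hH [h1 h2]; split; first exact: S1_app3.
exact: (S1_app3 (R := fun x y z => ~ R x y z)).
Qed.

Lemma T1_app (H : M -> M) F :
  T1 (fun e => H (e 0)) -> T1 F -> T1 (fun e => H (F e)).
Proof.
by move=> hH hF; apply: (S1_app2 (R := fun x y => x = H y)); 
  [exact: T1_var|exact: T1_tail|exact: hH].
Qed.

Lemma T1_app2 (H : M -> M -> M) F G :
  T1 (fun e => H (e 0) (e 1)) -> T1 F -> T1 G -> T1 (fun e => H (F e) (G e)).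
Proof.
by move=> hH hF hG; apply: (S1_app3 (R := fun x y z => x = H y z)); 
  [exact: T1_var|exact: T1_tail|exact: T1_tail|exact: hH].
Qed.

Lemma D1_mem F G : T1 F -> T1 G -> D1 (fun e => F e ∈ G e).
Proof.
move=> hF hG; apply: (D1_app2 (R := fun x y => x ∈ y)) => //.
by apply/D1_D0/D0_mem; exact: term_var.
Qed.

Lemma D1_eq F G : T1 F -> T1 G -> D1 (fun e => F e = G e).
Proof.
move=> hF hG; apply: (D1_app2 (R := fun x y => x = y)) => //.
by apply/D1_D0/D0_eq; exact: term_var.
Qed.

Lemma S1_tail1 (Q : M -> (nat -> M) -> Prop) :
  S1 (fun e => Q (e 0) (fun n => e n.+1)) ->
  S1 (fun e => Q (e 0) (fun n => e n.+2)).
Proof.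
exact: (S1_subst (fun n => if n is k.+1 then inl k.+2 else inl 0)).
Qed.

Lemma S1_ball F (Q : M -> (nat -> M) -> Prop) : T1 F ->
  S1 (fun e => Q (e 0) (fun n => e n.+1)) ->
  S1 (fun e => forall m, m ∈ F e -> Q m e).
Proof.
move=> hF hQ; apply: (S1_app (Q := fun x e => forall m, m ∈ x -> Q m e) hF).
apply: (S1_ball_term (Q := fun m e => Q m (fun n => e n.+1))).
  exact: term_var.
exact: S1_tail1 hQ.
Qed.

Lemma S1_bex F (Q : M -> (nat -> M) -> Prop) : T1 F ->
  S1 (fun e => Q (e 0) (fun n => e n.+1)) ->
  S1 (fun e => exists m, m ∈ F e /\ Q m e).
Proof.
move=> hF hQ; apply: S1_ex; apply: S1_and hQ.
by apply: (D1_mem _ _).1; [exact: T1_var|exact: T1_tail].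
Qed.

Lemma D1_bex F (Q : M -> (nat -> M) -> Prop) : T1 F ->
  D1 (fun e => Q (e 0) (fun n => e n.+1)) ->
  D1 (fun e => exists m, m ∈ F e /\ Q m e).
Proof.
move=> hF [h1 h2]; split; first exact: S1_bex.
apply: S1_ext (S1_ball (Q := fun m e => ~ Q m e) hF h2) => e.
rewrite -forallNP; split=> [h m [/h]//|h m me q]; exact: (h m).
Qed.

Lemma D1_ball F (Q : M -> (nat -> M) -> Prop) : T1 F ->
  D1 (fun e => Q (e 0) (fun n => e n.+1)) ->
  D1 (fun e => forall m, m ∈ F e -> Q m e).
Proof.
move=> hF hQ.
apply: D1_ext (D1_not (D1_bex (Q := fun m e => ~ Q m e) hF (D1_not hQ))) => e.
rewrite -forallNP; split=> [h m me|h m [/h]//].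
by apply: contrapT => nq; apply: (h m).
Qed.

Lemma S2_D1 P : D1 P -> S2 P. Proof. by move=> [/S2_S1]. Qed.

Lemma D1_subst P (f : nat -> nat + M) : D1 P -> D1 (fun e => P (val f e)).
Proof. by move=> [h1 h2]; split; [exact: S1_subst|exact: (S1_subst f h2)]. Qed.

Lemma D1_param (Q : M -> (nat -> M) -> Prop) e0 :
  D1 (fun e => Q (e 0) (fun n => e n.+1)) -> D1 (fun e => Q (e 0) e0).
Proof.
exact: (D1_subst (fun n => if n is k.+1 then inr (e0 k) else inl 0)).
Qed.

Lemma T1_param (F : M -> (nat -> M) -> M) e0 :
  T1 (fun e => F (e 0) (fun n => e n.+1)) -> T1 (fun e => F (e 0) e0).
Proof.
exact: (S1_subst (fun n => if n is k.+1 then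
  if k is j.+1 then inr (e0 j) else inl 1 else inl 0)).
Qed.

Lemma separationD1 (P : M -> Prop) x : D1 (fun e => P (e 0)) ->
  exists w, forall z, z ∈ w <-> z ∈ x /\ P z.
Proof. by move=> /S2_D1; exact: separationS2. Qed.

Lemma inductionD1 (P : M -> Prop) : D1 (fun e => P (e 0)) ->
  (forall x, (forall y, y ∈ x -> P y) -> P x) -> forall x, P x.
Proof. by move=> /S2_D1; exact: inductionS2. Qed.

Lemma collection (Q : M -> M -> Prop) x : S1 (fun e => Q (e 0) (e 1)) ->
  (forall u, u ∈ x -> exists v, Q v u) ->
  exists y, forall u, u ∈ x -> exists v, v ∈ y /\ Q v u.
Proof.
move=> [R hR QR] h; have [e _] := someM.
pose R' e := exists v, v ∈ e 0 /\ exists m, m ∈ e 0 /\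
  R (scons m (scons v (fun n => e n.+1))).
have hR' : D0 R'.
  apply: D0_bex; first exact: term_var.
  apply: D0_bex; first exact: term_var.
  pose f n : nat + M :=
    if n is k.+1 then if k is j.+1 then inl j.+3 else inl 1 else inl 0.
  apply: definable_ext (definable_subst f hR) => e'.
  suff -> : val f e' = scons (e' 0) (scons (e' 1) (fun n => e' n.+3)) by [].
  by apply/funext => -[|[|n]].
have [u /h[v /(QR (scons v (scons u e)))[m hm]]|y hy] :=
    collectionD0 (e := e) (x := x) hR'.
  have [w hw] := pairing m v; exists w; exists v.
  by split; [apply/hw; right|exists m; split=> //; apply/hw; left].
have [Y hY] := unions y; exists Y => u /hy[w [wy [v [vw [m [_ hm]]]]]].
exists v; split; first by apply/hY; exists w.
by apply/(QR (scons v (scons u e))); exists m.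
Qed.

(** * Set-theoretic functions *)


Lemma setof_ex (P : M -> Prop) :
  exists w, (exists w', forall z, z ∈ w' <-> P z) ->
    forall z, z ∈ w <-> P z.
Proof.
have [[w hw]|h] := pselect (exists w, forall z, z ∈ w <-> P z).
  by exists w.
by have [m] := inh; exists m => /h.
Qed.

(** The set of all elements satisfying [P] when there is one, and an arbitrary
    element otherwise. *)
Definition setof (P : M -> Prop) : M := projT1 (cid (setof_ex P)).

Lemma setofE (P : M -> Prop) z :
  (exists w, forall z, z ∈ w <-> P z) -> z ∈ setof P <-> P z.
Proof. by move=> h; apply: (projT2 (cid (setof_ex P))). Qed.

(** A set former has a Sigma_1 graph as soon as being the set in question can be
    expressed by a Sigma_1 predicate [C], usually one where the comprehension
    property has been broken into bounded quantifications. *)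
Lemma S1_setof (P : M -> (nat -> M) -> Prop) (C : (nat -> M) -> Prop) :
  (forall e, exists w, forall z, z ∈ w <-> P z e) ->
  (forall e, C e <-> forall z, z ∈ e 0 <-> P z (fun n => e n.+1)) ->
  S1 C -> T1 (fun e => setof (fun z => P z e)).
Proof.
move=> hP hC; apply: S1_ext => e; rewrite hC; split=> [h|-> z]; last first.
  exact: (setofE z (hP _)).
by apply: ext => z; rewrite h (setofE z (hP _)).
Qed.

Definition emp := setof (fun=> False).
Definition upair x y := setof (fun z => z = x \/ z = y).
Definition bigU x := setof (fun z => exists y, y ∈ x /\ z ∈ y).
Definition pow x := setof (fun z => forall y, y ∈ z -> y ∈ x).
Definition sep x (P : M -> Prop) := setof (fun z => z ∈ x /\ P z).
Definition rep x (F : M -> M) := setof (fun z => exists y, y ∈ x /\ z = F y).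
Definition sing x := upair x x.
Definition cup x y := bigU (upair x y).
Definition opair x y := upair (sing x) (upair x y).

Lemma empE z : ~ z ∈ emp.
Proof.
have [e _] := someM.
have [w hw] := @separationD1 (fun=> False) (e 0) (D1_const False).
rewrite /emp setofE //; exists w => y.
by rewrite hw; split=> [[]|].
Qed.

Lemma upairE x y z : z ∈ upair x y <-> z = x \/ z = y.
Proof. exact/setofE/pairing. Qed.

Lemma bigUE x z : z ∈ bigU x <-> exists y, y ∈ x /\ z ∈ y.
Proof. exact/setofE/unions. Qed.

Lemma powE x z : z ∈ pow x <-> forall y, y ∈ z -> y ∈ x.
Proof. exact/setofE/powers. Qed.

Lemma sepE2 x (P : M -> Prop) z :
  S2 (fun e => P (e 0)) -> z ∈ sep x P <-> z ∈ x /\ P z.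
Proof. by move=> hP; apply/setofE/separationS2. Qed.

Lemma sepE x (P : M -> Prop) z :
  D1 (fun e => P (e 0)) -> z ∈ sep x P <-> z ∈ x /\ P z.
Proof. by move=> /S2_D1; exact: sepE2. Qed.

Lemma rep_ex x (F : M -> M) : T1 (fun e => F (e 0)) ->
  exists w, forall z, z ∈ w <-> exists y, y ∈ x /\ z = F y.
Proof.
move=> hF.
have [|u _|y hy] := @collection (fun v u => v = F u) x; first exact: hF.
  by exists (F u).
have [|w hw] := @separationD1 (fun z => exists u, u ∈ x /\ z = F u) y.
  apply: (D1_bex (Q := fun u e => e 0 = F u)); first exact: T1_const.
  apply: (D1_eq (F := fun e => e 1)); first exact: T1_var.
  exact: T1_app hF (T1_var 0).
exists w => z; rewrite hw; split=> [[]|[u [ux zu]]] //.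
by have [v [vy vu]] := hy u ux; rewrite zu -vu; split=> //;
  exists u; rewrite vu.
Qed.

Lemma repE x (F : M -> M) z : T1 (fun e => F (e 0)) ->
  z ∈ rep x F <-> exists y, y ∈ x /\ z = F y.
Proof. by move=> hF; apply/setofE/rep_ex. Qed.

Lemma singE x z : z ∈ sing x <-> z = x.
Proof. by rewrite upairE; split=> [[]|]; auto. Qed.

Lemma cupE x y z : z ∈ cup x y <-> z ∈ x \/ z ∈ y.
Proof.
rewrite bigUE; split=> [[u []]|[h|h]].
- by rewrite upairE => -[]->; auto.
- by exists x; rewrite upairE; auto.
- by exists y; rewrite upairE; auto.
Qed.

Lemma opair_inj x y x' y' : opair x y = opair x' y' -> x = x' /\ y = y'.
Proof.
move=> E; have xx : x = x'.
  have : sing x' ∈ opair x y by rewrite E upairE; left.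
  rewrite upairE => -[] h.
    have : x' ∈ sing x' by apply/singE.
    by rewrite h singE.
  have : x ∈ upair x y by apply/upairE; left.
  by rewrite -h singE.
subst x'; split=> //.
have hy : upair x y ∈ opair x y' by rewrite -E upairE; right.
have hy' : upair x y' ∈ opair x y by rewrite E upairE; right.
have [h|h] := (upairE _ _ _).1 hy.
  have yx : y = x.
    have : y ∈ upair x y by apply/upairE; right.
    by rewrite h singE.
  have [h'|h'] := (upairE _ _ _).1 hy'.
    have : y' ∈ upair x y' by apply/upairE; right.
    by rewrite h' singE => ->.
  have : y' ∈ upair x y by rewrite -h'; apply/upairE; right.
  by rewrite upairE => -[] ->.
have : y ∈ upair x y' by rewrite -h; apply/upairE; right.
rewrite upairE => -[yx|//]; subst y.
have : y' ∈ upair x x by rewrite h; apply/upairE; right.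
by rewrite upairE => -[] ->.
Qed.

Lemma T1_upair F G : T1 F -> T1 G -> T1 (fun e => upair (F e) (G e)).
Proof.
apply: (T1_app2 (H := upair)).
apply: (S1_setof (P := fun z e => z = e 0 \/ z = e 1)
  (C := fun e => (e 1 ∈ e 0 /\ e 2 ∈ e 0) /\
     forall z, z ∈ e 0 -> z = e 1 \/ z = e 2)) => [e|e|].
- exact: pairing.
- split=> [[[h1 h2] h] z|h]; first by split=> [/h|[]->].
  by split=> [|z /h//]; split; apply/h; auto.
- apply: (_ : D1 _).1; apply: D1_and.
    by apply: D1_and; apply: D1_mem; exact: T1_var.
  apply: (D1_ball (Q := fun z e => z = e 1 \/ z = e 2)); first exact: T1_var.
  by apply: D1_or; apply: D1_eq; exact: T1_var.
Qed.

Lemma T1_bigU F : T1 F -> T1 (fun e => bigU (F e)).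
Proof.
apply: (T1_app (H := bigU)).
apply: (S1_setof (P := fun z e => exists y, y ∈ e 0 /\ z ∈ y)
  (C := fun e => (forall y, y ∈ e 1 -> forall z, z ∈ y -> z ∈ e 0) /\
     forall z, z ∈ e 0 -> exists y, y ∈ e 1 /\ z ∈ y)) => [e|e|].
- exact: unions.
- split=> [[h1 h] z|h]; first by split=> [/h|[y [ye zy]]] //; exact: h1 zy.
  split=> [y ye z zy|z /h//]; by apply/h; exists y.
- apply: (_ : D1 _).1; apply: D1_and.
    apply: (D1_ball (Q := fun y e => forall z, z ∈ y -> z ∈ e 0)).
      exact: T1_var.
    apply: (D1_ball (Q := fun z e => z ∈ e 1)); first exact: T1_var.
    by apply: D1_mem; exact: T1_var.
  apply: (D1_ball (Q := fun z e => exists y, y ∈ e 1 /\ z ∈ y)).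
    exact: T1_var.
  apply: (D1_bex (Q := fun y e => e 0 ∈ y)); first exact: T1_var.
  by apply: D1_mem; exact: T1_var.
Qed.

Lemma T1_pow F : T1 F -> T1 (fun e => pow (F e)).
Proof.
apply: (T1_app (H := pow)).
apply: (S1_setof (P := fun z e => forall y, y ∈ z -> y ∈ e 0)
  (C := fun e => (forall z, (forall y, y ∈ z -> y ∈ e 1) -> z ∈ e 0) /\
     forall z, z ∈ e 0 -> forall y, y ∈ z -> y ∈ e 1)) => [e|e|].
- exact: powers.
- split=> [[h1 h] z|h]; first by split=> [/h|/h1].
  by split=> z /h.
- apply/S1_D0/D0_and.
    apply: (D0_ball_sub (t := fun e => e 1) (Q := fun z e => z ∈ e 0)).
      exact: term_var.
    by apply: D0_mem; exact: term_var.
  apply: (D0_ball (Q := fun z e => forall y, y ∈ z -> y ∈ e 1)).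
    exact: term_var.
  apply: (D0_ball (Q := fun z e => z ∈ e 2)); first exact: term_var.
  by apply: D0_mem; exact: term_var.
Qed.

Lemma T1_sep F (Q : M -> (nat -> M) -> Prop) : T1 F ->
  D1 (fun e => Q (e 0) (fun n => e n.+1)) ->
  T1 (fun e => sep (F e) (fun z => Q z e)).
Proof.
move=> hF hQ.
have hQ' := D1_subst (fun n => if n is k.+1 then inl k.+2 else inl 0) hQ.
apply: (S1_setof (P := fun z e => z ∈ F e /\ Q z e)
  (C := fun e =>
     (forall z, z ∈ F (fun n => e n.+1) ->
        Q z (fun n => e n.+1) -> z ∈ e 0) /\
     (forall z, z ∈ e 0 -> z ∈ F (fun n => e n.+1) /\
        Q z (fun n => e n.+1)))) => [e|e|].
- exact/separationD1/(D1_param e hQ).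
- split=> [[h1 h] z|h]; first by split=> [/h|[]] //; exact: h1.
  by split=> [z h1 h2|z /h//]; apply/h.
- apply: (_ : D1 _).1; apply: D1_and.
    apply: (D1_ball (Q := fun z e => Q z (fun n => e n.+1) -> z ∈ e 0)).
      exact: T1_tail.
    apply: D1_imp; first exact: hQ'.
    by apply: D1_mem; exact: T1_var.
  apply: (D1_ball (Q := fun z e => z ∈ F (fun n => e n.+1) /\
        Q z (fun n => e n.+1))); first exact: T1_var.
  apply: D1_and; last exact: hQ'.
  apply: D1_mem; first exact: T1_var.
  exact: (T1_tail (T1_tail hF)).
Qed.

Lemma T1_rep F (H : M -> (nat -> M) -> M) : T1 F ->
  T1 (fun e => H (e 0) (fun n => e n.+1)) ->
  T1 (fun e => rep (F e) (fun z => H z e)).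
Proof.
move=> hF hH.
have hH' : T1 (fun e => H (e 0) (fun n => e n.+2)).
  exact: (S1_subst (fun n => if n is k.+1 then
    if k is j.+1 then inl j.+3 else inl 1 else inl 0) hH).
have hH'' : T1 (fun e => H (e 0) (fun n => e n.+3)).
  exact: (S1_subst (fun n => if n is k.+1 then
    if k is j.+1 then inl j.+4 else inl 1 else inl 0) hH).
apply: (S1_setof (P := fun z e => exists y, y ∈ F e /\ z = H y e)
  (C := fun e =>
     (forall y, y ∈ F (fun n => e n.+1) -> H y (fun n => e n.+1) ∈ e 0) /\
     (forall z, z ∈ e 0 -> exists y, y ∈ F (fun n => e n.+1) /\
        z = H y (fun n => e n.+1)))) => [e|e|].
- exact/rep_ex/(T1_param e hH).
- split=> [[h1 h] z|h]; first by split=> [/h|[y [ye ->]]] //; exact: h1.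
  by split=> [y ye|z /h//]; apply/h; exists y.
- apply: (_ : D1 _).1; apply: D1_and.
    apply: (D1_ball (Q := fun y e => H y (fun n => e n.+1) ∈ e 0)).
      exact: T1_tail.
    by apply: D1_mem; last exact: T1_var.
  apply: (D1_ball (Q := fun z e => exists y, y ∈ F (fun n => e n.+1) /\
        z = H y (fun n => e n.+1))); first exact: T1_var.
  apply: (D1_bex (Q := fun y e => e 0 = H y (fun n => e n.+2))).
    exact: (T1_tail (T1_tail hF)).
  by apply: D1_eq; first exact: T1_var.
Qed.

(** [df] proves goals [D1 P] and [T1 F] by recursion on the syntax of [P] and
    [F].  [T1_known] and [D1_known] are redefined below each time that a new
    function or predicate is available. *)
Ltac T1_hyps := match goal with
  | h : T1 (fun e => ?H (e 0)) |- T1 (fun e => ?H (@?F e)) =>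
      refine (T1_app (F := F) h _); df
  | h : T1 (fun e => ?H (e 0) (e 1)) |- T1 (fun e => ?H (@?F e) (@?G e)) =>
      refine (T1_app2 (F := F) (G := G) h _ _); df
  end
with T1_known := T1_hyps
with D1_known := fail
with df := cbv beta; match goal with
  | |- _ => assumption
  | |- T1 (fun e => e ?n) => exact: T1_var
  | |- T1 (fun _ => ?c) => exact: T1_const
  | |- T1 (fun e => upair (@?F e) (@?G e)) =>
      refine (T1_upair (F := F) (G := G) _ _); df
  | |- T1 (fun e => bigU (@?F e)) => refine (T1_bigU (F := F) _); df
  | |- T1 (fun e => pow (@?F e)) => refine (T1_pow (F := F) _); df
  | |- T1 (fun e => sep (@?F e) (fun z => @?Q e z)) =>
      refine (T1_sep (F := F) (Q := fun z e => Q e z) _ _); df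
  | |- T1 (fun e => rep (@?F e) (fun z => @?H e z)) =>
      refine (T1_rep (F := F) (H := fun z e => H e z) _ _); df
  | |- D1 (fun _ => ?p) => exact: D1_const
  | |- D1 (fun e => @elt _ (@?F e) (@?G e)) =>
      refine (D1_mem (F := F) (G := G) _ _); df
  | |- D1 (fun e => @eq _ (@?F e) (@?G e)) =>
      refine (D1_eq (F := F) (G := G) _ _); df
  | |- D1 (fun e => (@?P e) /\ (@?Q e)) =>
      refine (D1_and (P := P) (Q := Q) _ _); df
  | |- D1 (fun e => (@?P e) \/ (@?Q e)) =>
      refine (D1_or (P := P) (Q := Q) _ _); df
  | |- D1 (fun e => (@?P e) <-> (@?Q e)) =>
      refine (D1_iff (P := P) (Q := Q) _ _); df
  | |- D1 (fun e => ~ (@?P e)) => refine (D1_not (P := P) _); df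
  | |- D1 (fun e => forall m, elt m (@?F e) -> (@?Q e m)) =>
      refine (D1_ball (F := F) (Q := fun m e => Q e m) _ _); df
  | |- D1 (fun e => exists m, elt m (@?F e) /\ (@?Q e m)) =>
      refine (D1_bex (F := F) (Q := fun m e => Q e m) _ _); df
  | |- D1 (fun e => (@?P e) -> (@?Q e)) =>
      refine (D1_imp (P := P) (Q := Q) _ _); df
  | |- T1 _ => T1_known
  | |- D1 _ => D1_known
  | |- _ => idtac
  end.

Lemma T1_sing F : T1 F -> T1 (fun e => sing (F e)).
Proof. by rewrite /sing => hF; df. Qed.

Lemma T1_cup F G : T1 F -> T1 G -> T1 (fun e => cup (F e) (G e)).
Proof. by rewrite /cup => hF hG; df. Qed.

Lemma T1_opair F G : T1 F -> T1 G -> T1 (fun e => opair (F e) (G e)).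
Proof. by move=> hF hG; apply: T1_upair; [exact: T1_sing|exact: T1_upair]. Qed.

Ltac T1_pairs := match goal with
  | |- T1 (fun e => sing (@?F e)) => refine (T1_sing (F := F) _); df
  | |- T1 (fun e => cup (@?F e) (@?G e)) =>
      refine (T1_cup (F := F) (G := G) _ _); df
  | |- T1 (fun e => opair (@?F e) (@?G e)) =>
      refine (T1_opair (F := F) (G := G) _ _); df
  end.
Ltac T1_known ::= first [T1_hyps | T1_pairs].

(** The projections are defined on all sets, and are meaningful on pairs. *)
Definition fst p :=
  bigU (sep (bigU p) (fun x => exists y, y ∈ bigU p /\ p = opair x y)).
Definition snd p :=
  bigU (sep (bigU p) (fun y => exists x, x ∈ bigU p /\ p = opair x y)).

Lemma bigU_opair x y z : z ∈ bigU (opair x y) <-> z = x \/ z = y.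
Proof.
rewrite bigUE; split=> [[w []]|].
  by rewrite upairE => -[]-> /upairE[]; auto.
by move=> h; exists (upair x y); rewrite !upairE; auto.
Qed.

Lemma fst_opair x y : fst (opair x y) = x.
Proof.
apply: ext => z; rewrite /fst bigUE; split=> [[w]|zx].
  rewrite sepE; last by df.
  by move=> [[_ [v [_ /opair_inj[<-]]]]].
exists x; split=> //; apply/sepE; first by df.
split; first by apply/bigU_opair; left.
by exists y; split=> //; apply/bigU_opair; right.
Qed.

Lemma snd_opair x y : snd (opair x y) = y.
Proof.
apply: ext => z; rewrite /snd bigUE; split=> [[w]|zx].
  rewrite sepE; last by df.
  by move=> [[_ [v [_ /opair_inj[_ <-]]]]].
exists y; split=> //; apply/sepE; first by df.
split; first by apply/bigU_opair; right.
by exists x; split=> //; apply/bigU_opair; left.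
Qed.

Lemma T1_fst F : T1 F -> T1 (fun e => fst (F e)).
Proof. by apply: (T1_app (H := fst)); rewrite /fst; df. Qed.

Lemma T1_snd F : T1 F -> T1 (fun e => snd (F e)).
Proof. by apply: (T1_app (H := snd)); rewrite /snd; df. Qed.

Ltac T1_projections := match goal with
  | |- T1 (fun e => fst (@?F e)) => refine (T1_fst (F := F) _); df
  | |- T1 (fun e => snd (@?F e)) => refine (T1_snd (F := F) _); df
  end.
Ltac T1_known ::= first [T1_hyps | T1_pairs | T1_projections].

(** Cantor's theorem: if [f] were injective, the image of its diagonal set would
    belong to that set if and only if it did not.  The diagonal set exists
    because [f] is definable. *)
Lemma cantor (f : M -> M) K : T1 (fun e => f (e 0)) ->
  (forall x, x ∈ pow K -> f x ∈ K) ->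
  exists x y, [/\ x ∈ pow K, y ∈ pow K, x <> y & f x = f y].
Proof.
move=> fT fK; apply: contrapT => inj.
have {}inj x y : x ∈ pow K -> y ∈ pow K -> f x = f y -> x = y.
  by move=> xK yK E; apply: contrapT => xy; apply: inj; exists x, y.
pose C := sep K (fun v => exists x, x ∈ pow K /\ (f x = v /\ ~ v ∈ x)).
have CE v : v ∈ C <->
    v ∈ K /\ exists x, x ∈ pow K /\ (f x = v /\ ~ v ∈ x).
  by apply: sepE; df.
have CK : C ∈ pow K by apply/powE => v /CE[].
have nC : ~ f C ∈ C.
  by move=> /[dup] fC /CE[_ [x [xK [/(inj _ _ xK CK) ->]]]].
by apply: (nC); apply/CE; split; [exact: fK|exists C].
Qed.

(** * Recursion *)

(** Recursion along the relation that [y] is in [pred x].  [G] receives the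
    argument and the graph of the function on its predecessors. *)
Section Recursion.
Variables (pred : M -> M) (G : M -> M -> M).
Hypothesis predT : T1 (fun e => pred (e 0)).
Hypothesis GT : T1 (fun e => G (e 0) (e 1)).
Hypothesis pred_ind : forall P : M -> Prop, S1 (fun e => P (e 0)) ->
  (forall x, (forall y, y ∈ pred x -> P y) -> P x) -> forall x, P x.

Definition below f x := sep f (fun q => fst q ∈ pred x).

Lemma belowE f x q : q ∈ below f x <-> q ∈ f /\ fst q ∈ pred x.
Proof. by apply: sepE; df. Qed.

(** The set functions that have a domain closed under predecessors and satisfy
    the recursion equation. *)
Definition attempt f :=
  [/\ forall p, p ∈ f -> p = opair (fst p) (snd p),
      forall p, p ∈ f -> forall q, q ∈ f -> fst p = fst q -> p = q,
      forall p, p ∈ f -> forall y, y ∈ pred (fst p) ->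
        exists q, q ∈ f /\ fst q = y &
      forall p, p ∈ f -> snd p = G (fst p) (below f (fst p))].

Lemma D1_attempt : D1 (fun e => attempt (e 0)).
Proof.
apply: (@D1_ext (fun e => ((forall p, p ∈ e 0 -> p = opair (fst p) (snd p)) /\
  (forall p, p ∈ e 0 -> forall q, q ∈ e 0 -> fst p = fst q -> p = q)) /\
  ((forall p, p ∈ e 0 -> forall y, y ∈ pred (fst p) ->
        exists q, q ∈ e 0 /\ fst q = y) /\
  (forall p, p ∈ e 0 -> snd p = G (fst p) (below (e 0) (fst p)))))).
  by move=> e; split=> [[[? ?] []]|[]].
by rewrite /below; df.
Qed.

Lemma attempt_unique f g : attempt f -> attempt g ->
  forall x p q, p ∈ f -> q ∈ g -> fst p = x -> fst q = x -> p = q.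
Proof.
move=> [f1 f2 f3 f4] [g1 g2 g3 g4] x p q.
pose P x := forall p, p ∈ f -> forall q, q ∈ g -> fst p = x -> fst q = x ->
  p = q.
suff h : forall x, P x by move=> pf qg; exact: h.
apply: pred_ind => [|{}x IH {}p pf {}q qg px qx].
  by apply: (_ : D1 _).1; rewrite /P; df.
have E : below f x = below g x.
  apply: ext => r; rewrite !belowE; split=> -[rf rx]; split=> //.
    have [q' [q'g E]] : exists q', q' ∈ g /\ fst q' = fst r.
      by apply: (g3 q) => //; rewrite qx.
    by have -> : r = q' by apply: (IH _ rx).
  have [p' [p'f E]] : exists p', p' ∈ f /\ fst p' = fst r.
    by apply: (f3 p) => //; rewrite px.
  by have <- : p' = r by apply: (IH _ rx).
by rewrite (f1 p) // (g1 q) // (f4 p) // (g4 q) // px qx E.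
Qed.

Lemma attempt_bigU Z : (forall f, f ∈ Z -> attempt f) -> attempt (bigU Z).
Proof.
move=> hZ; split=> [p|p|p|p] /bigUE[f [fZ pf]]; have [f1 f2 f3 f4] := hZ _ fZ.
- exact: f1.
- move=> q /bigUE[g [gZ qg]] pq.
  exact: (attempt_unique (hZ f fZ) (hZ g gZ) pf qg pq).
- move=> y /(f3 p pf)[q [qf <-]].
  by exists q; split=> //; apply/bigUE; exists f.
- rewrite f4 //; congr G; apply: ext => q.
  rewrite !belowE bigUE; split=> -[qf qp]; split=> //; first by exists f.
  have [g [gZ qg]] := qf.
  have [r [rf rq]] := f3 p pf _ qp.
  by rewrite -(attempt_unique (hZ f fZ) (hZ g gZ) rf qg rq).
Qed.

Lemma attempt_step g x : attempt g ->
  (forall y, y ∈ pred x -> exists q, q ∈ g /\ fst q = y) ->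
  (~ exists p, p ∈ g /\ fst p = x) ->
  attempt (cup g (sing (opair x (G x (below g x))))).
Proof.
move=> [g1 g2 g3 g4] gx xg; set h := cup _ _.
have hE p : p ∈ h <-> p ∈ g \/ p = opair x (G x (below g x)).
  by rewrite cupE singE.
have bE z : ~ x ∈ pred z -> below h z = below g z.
  move=> xz; apply: ext => q; rewrite !belowE hE.
  split=> [[[qg|->] qz]|[qg qz]]; split=> //; last by left.
  by case: xz; rewrite fst_opair in qz.
split=> p /hE[pg|->].
- exact: g1.
- by rewrite fst_opair snd_opair.
- move=> q /hE[qg|-> px]; first exact: g2.
  by case: xg; exists p; rewrite px fst_opair.
- move=> q /hE[qg px|->] //.
  by case: xg; exists q; rewrite -px fst_opair.
- by move=> y /(g3 p pg)[q [qg <-]]; exists q; rewrite hE; split=> //; left.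
- rewrite fst_opair => y /gx[q [qg <-]].
  by exists q; rewrite hE; split=> //; left.
- by rewrite g4 // bE // => /(g3 p pg).
- by rewrite fst_opair snd_opair bE // => /gx.
Qed.

(** Induction for Sigma_1 predicates: attempts at the predecessors of [x] are
    collected into a set, pasted together, and extended to [x]. *)
Lemma attempt_exists x : exists f, attempt f /\ exists p, p ∈ f /\ fst p = x.
Proof.
move: x; apply: pred_ind.
  apply: (S1_ex (Q := fun f e => attempt f /\
    exists p, p ∈ f /\ fst p = e 0)).
  apply: (_ : D1 _).1; apply: D1_and; last by df.
  exact: (D1_subst inl D1_attempt).
move=> x IH.
have [||Y hY] := @collection (fun f y => attempt f /\
  exists p, p ∈ f /\ fst p = y) (pred x).
- apply: (_ : D1 _).1; apply: D1_and; last by df.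
  exact: (D1_subst inl D1_attempt).
- exact: IH.
pose g := bigU (sep Y attempt).
have ZE f : f ∈ sep Y attempt <-> f ∈ Y /\ attempt f.
  exact/sepE/D1_attempt.
have ga : attempt g by apply: attempt_bigU => f /ZE[].
have gx y : y ∈ pred x -> exists q, q ∈ g /\ fst q = y.
  move=> /hY[f [fY [fa [p [pf <-]]]]]; exists p; split=> //.
  by apply/bigUE; exists f; rewrite ZE.
have [h|h] := pselect (exists p, p ∈ g /\ fst p = x); first by exists g.
exists (cup g (sing (opair x (G x (below g x))))); split.
  exact: attempt_step.
exists (opair x (G x (below g x))); rewrite fst_opair; split=> //.
by apply/cupE; right; apply/singE.
Qed.

Theorem recursion : exists F : M -> M, T1 (fun e => F (e 0)) /\
  forall x, F x = G x (rep (pred x) (fun y => opair y (F y))).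
Proof.
pose Val x v := exists f, attempt f /\ opair x v ∈ f.
have VE x : exists v, Val x v.
  have [f [fa [p [pf px]]]] := attempt_exists x; exists (snd p), f.
  by split=> //; rewrite -px; case: fa => <-.
have VU x v w : Val x v -> Val x w -> v = w.
  move=> [f [fa vf]] [g [ga wg]].
  have := attempt_unique fa ga vf wg (fst_opair x v) (fst_opair x w).
  by move=> /opair_inj[].
have [F hF] := choice VE.
have FT : T1 (fun e => F (e 0)).
  apply: (@S1_ext M (fun e => exists f, attempt f /\ opair (e 1) (e 0) ∈ f)).
    by move=> e; split=> [h|->]; [exact: VU h (hF _)|exact: hF].
  apply: (S1_ex (Q := fun f e => attempt f /\ opair (e 1) (e 0) ∈ f)).
  apply: (_ : D1 _).1; apply: D1_and; last by df.
  exact: (D1_subst inl D1_attempt).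
exists F; split=> // x.
have [f [fa xf]] := hF x.
have [f1 f2 f3 f4] := fa.
have := f4 _ xf; rewrite snd_opair fst_opair => ->; congr G.
apply: ext => q; rewrite belowE repE; last by df.
split=> [[qf qx]|[y [yx ->]]].
  exists (fst q); split=> //; rewrite {1}(f1 q qf); congr opair.
  by apply: (VU (fst q)) => //; exists f; split=> //; rewrite -f1.
rewrite fst_opair; split=> //.
have [|r [rf ry]] := f3 _ xf y; first by rewrite fst_opair.
suff -> : F y = snd r by rewrite -ry -f1.
by apply: (VU y) => //; exists f; split=> //; rewrite -ry -f1.
Qed.

End Recursion.

(** * Ordinals, ranks and the cumulative hierarchy *)

Lemma elt_irrefl x : ~ x ∈ x.
Proof.
by move: x; apply: inductionD1 => [|x IH xx]; [df|exact: (IH x)].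
Qed.

Lemma Ord_trans a b c : Ord a -> c ∈ b -> b ∈ a -> c ∈ a.
Proof. by move=> [h _]; exact: h. Qed.

Lemma Ord_elt a b : Ord a -> b ∈ a -> Ord b.
Proof. by move=> [h1 h2] ba; split=> [|c cb]; [exact: h2|exact/h2/h1/ba]. Qed.

Lemma Ord_bounded x : Ord x <->
  (forall y, y ∈ x -> forall z, z ∈ y -> z ∈ x) /\
  (forall y, y ∈ x -> forall u, u ∈ y -> forall z, z ∈ u -> z ∈ y).
Proof.
split=> -[h1 h2]; split.
- by move=> y yx z zy; exact: h1 zy yx.
- by move=> y yx u uy z zu; exact: (h2 y yx) zu uy.
- by move=> y z zy yx; exact: h1 yx z zy.
- by move=> y yx u z zu uy; exact: h2 yx u uy z zu.
Qed.

Lemma D1_Ord F : T1 F -> D1 (fun e => Ord (F e)).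
Proof.
move=> hF; apply: (D1_ext (fun e => iff_sym (Ord_bounded (F e)))).
by apply: (D1_app (Q := fun x e => 
  (forall y, y ∈ x -> forall z, z ∈ y -> z ∈ x) /\
  (forall y, y ∈ x -> forall u, u ∈ y -> forall z, z ∈ u -> z ∈ y))) => //;
  df.
Qed.

(** A double induction, Pi_1 on the outside. *)
Lemma Ord_total a b : Ord a -> Ord b -> [\/ a ∈ b, a = b | b ∈ a].
Proof.
move: a b.
pose P a := forall b, Ord a -> Ord b -> a ∈ b \/ (a = b \/ b ∈ a).
suff h : forall a, P a.
  by move=> a b oa ob; case: (h a b) => // [|[]]; auto using or3.
apply: inductionS2 => [|a IHa].
  apply: S2_P1; apply: (@S1_ext M (fun e => exists b,
    ~ (Ord (e 0) -> Ord b -> e 0 ∈ b \/ (e 0 = b \/ b ∈ e 0)))).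
    by move=> e; rewrite /P -existsNE.
  apply: (S1_ex (Q := fun b e =>
    ~ (Ord (e 0) -> Ord b -> e 0 ∈ b \/ (e 0 = b \/ b ∈ e 0)))).
  by apply: (_ : D1 _).1; df; apply: D1_Ord; df.
apply: inductionD1 => [|b IHb oa ob].
  by df; apply: D1_Ord; df.
have [ab|ab] := pselect (a ∈ b); first by left.
have [ba|ba] := pselect (b ∈ a); first by right; right.
right; left; apply: ext => x; split=> [xa|xb].
  case: (IHa x xa b (Ord_elt oa xa) ob) => [//|[E|bx]]; case: ba.
    by rewrite -E.
  exact: Ord_trans bx xa.
case: (IHb x xb oa (Ord_elt ob xb)) => [ax|[E|//]]; case: ab.
  exact: Ord_trans ax xb.
by rewrite E.
Qed.

Lemma Ord_sub a b : Ord a -> Ord b -> (forall z, z ∈ a -> z ∈ b) ->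
  a ∈ b \/ a = b.
Proof.
move=> oa ob ab; case: (Ord_total oa ob) => h; [by left|by right|].
by case: (elt_irrefl (ab b h)).
Qed.

Definition sc x := cup x (sing x).

Lemma scE x z : z ∈ sc x <-> z ∈ x \/ z = x.
Proof. by rewrite cupE singE. Qed.

(** The pattern common to ranks and to the cumulative hierarchy. *)
Lemma elt_recursion (H : M -> M) : T1 (fun e => H (e 0)) ->
  exists F : M -> M, T1 (fun e => F (e 0)) /\
  forall x z, z ∈ F x <-> exists y, y ∈ x /\ z ∈ H (F y).
Proof.
move=> HT; have [| | |F [FT FE]] :=
    @recursion id (fun x r => bigU (rep r (fun p => H (snd p)))).
- exact: T1_var.
- by df.
- by move=> P /S2_S1; exact: inductionS2.
exists F; split=> // x z; rewrite FE bigUE; split=> [[w]|[y [yx zy]]].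
  rewrite repE; last by df.
  move=> [[p [+ ->]] zw]; rewrite repE; last by df.
  by move=> [y [yx pE]]; exists y; rewrite pE snd_opair in zw.
exists (H (F y)); split=> //; apply/repE; first by df.
exists (opair y (F y)); rewrite snd_opair; split=> //.
by apply/repE; [df|exists y].
Qed.

Lemma rk_exists : exists F : M -> M, T1 (fun e => F (e 0)) /\
  forall x z, z ∈ F x <-> exists y, y ∈ x /\ z ∈ sc (F y).
Proof. by apply: elt_recursion; rewrite /sc; df. Qed.

Lemma V_exists : exists F : M -> M, T1 (fun e => F (e 0)) /\
  forall x z, z ∈ F x <-> exists y, y ∈ x /\ z ∈ pow (F y).
Proof. by apply: elt_recursion; df. Qed.

(** [V x] is the level of the cumulative hierarchy indexed by the rank of [x]
    ([V_rk]); allowing arbitrary indices saves ordinal hypotheses. *)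
Definition rk : M -> M := projT1 (cid rk_exists).
Definition V : M -> M := projT1 (cid V_exists).

Lemma T1_rk F : T1 F -> T1 (fun e => rk (F e)).
Proof. by apply: T1_app; exact: (projT2 (cid rk_exists)).1. Qed.

Lemma T1_V F : T1 F -> T1 (fun e => V (F e)).
Proof. by apply: T1_app; exact: (projT2 (cid V_exists)).1. Qed.

Lemma rkE x z : z ∈ rk x <-> exists y, y ∈ x /\ (z ∈ rk y \/ z = rk y).
Proof.
have := (projT2 (cid rk_exists)).2 x z.
rewrite -/rk => ->; split=> -[y [yx h]]; exists y; split=> //.
  by move: h; rewrite scE.
by rewrite scE.
Qed.

Lemma VE x z : z ∈ V x <-> exists y, y ∈ x /\ forall u, u ∈ z -> u ∈ V y.
Proof.
have := (projT2 (cid V_exists)).2 x z.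
by rewrite -/V => ->; split=> -[y [yx h]]; exists y; move: h; rewrite powE.
Qed.

Ltac T1_ranks := match goal with
  | |- T1 (fun e => rk (@?F e)) => refine (T1_rk (F := F) _); df
  | |- T1 (fun e => V (@?F e)) => refine (T1_V (F := F) _); df
  end.
Ltac T1_known ::= first [T1_hyps | T1_pairs | T1_projections | T1_ranks].

Ltac D1_known ::= match goal with
  | |- D1 (fun e => Ord (@?F e)) => refine (D1_Ord (F := F) _); df
  end.

Lemma rk_elt x y : y ∈ x -> rk y ∈ rk x.
Proof. by move=> yx; apply/rkE; exists y; split=> //; right. Qed.

Lemma Ord_rk x : Ord (rk x).
Proof.
move: x; apply: inductionD1 => [|x IH]; first by df.
split=> [y z zy|y] /rkE[u [ux [h|E]]].
- by apply/rkE; exists u; split=> //; left; exact: Ord_trans (IH u ux) zy h.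
- by apply/rkE; exists u; split=> //; left; rewrite -E.
- exact: (Ord_elt (IH u ux) h).1.
- by rewrite E; exact: (IH u ux).1.
Qed.

Lemma rk_Ord a : Ord a -> rk a = a.
Proof.
move: a; apply: inductionD1 => [|a IH oa]; first by df.
apply: ext => z; rewrite rkE; split=> [[y [ya]]|za].
  rewrite (IH y ya (Ord_elt oa ya)) => -[zy|->] //; exact: Ord_trans zy ya.
by exists z; split=> //; right; rewrite IH //; exact: Ord_elt za.
Qed.

Lemma rk_sub x b : Ord b -> (forall z, z ∈ x -> rk z ∈ b) ->
  rk x ∈ b \/ rk x = b.
Proof.
move=> ob h; apply: Ord_sub => //; first exact: Ord_rk.
by move=> z /rkE[y [/h yb [zy|->]]] //; exact: Ord_trans zy yb.
Qed.

Lemma V_rk x y : x ∈ V y <-> rk x ∈ rk y.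
Proof.
split.
  pose P y := forall x, x ∈ V y -> rk x ∈ rk y.
  suff h z : P z by exact: h.
  move: z; apply: (@inductionD1 P) => [|{}y IH w /VE[z [zy xz]]].
    by rewrite /P; df.
  apply/rkE; exists z; split=> //.
  by apply: rk_sub => [|u /xz /(IH z zy)]; first exact: Ord_rk.
pose P y := forall x, rk x ∈ rk y -> x ∈ V y.
suff h z : P z by exact: h.
move: z; apply: (@inductionS2 P) => [|{}y IH w /rkE[z [zy h]]].
  apply: S2_P1; apply: (@S1_ext M (fun e => exists x,
    ~ (rk x ∈ rk (e 0) -> x ∈ V (e 0)))).
    by move=> e; rewrite /P -existsNE.
  apply: (S1_ex (Q := fun x e => ~ (rk x ∈ rk (e 0) -> x ∈ V (e 0)))).
  by apply: (_ : D1 _).1; df.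
apply/VE; exists z; split=> // u /rk_elt ux; apply: IH => //.
by case: h => [h|<- //]; exact: Ord_trans (Ord_rk z) ux h.
Qed.

Lemma V_Ord x a : Ord a -> x ∈ V a <-> rk x ∈ a.
Proof. by move=> oa; rewrite V_rk (rk_Ord oa). Qed.

Lemma V_trans x y z : x ∈ y -> y ∈ V z -> x ∈ V z.
Proof. by rewrite !V_rk => /rk_elt h; exact: (Ord_trans (Ord_rk z) h). Qed.

Lemma V_mono x y z : x ∈ V y -> y ∈ z -> x ∈ V z.
Proof. by rewrite !V_rk => h /rk_elt; exact: (Ord_trans (Ord_rk z) h). Qed.

Lemma V_self x y : x ∈ y -> x ∈ V y.
Proof. by rewrite V_rk; exact: rk_elt. Qed.

Lemma V_sub x y z : (forall u, u ∈ x -> u ∈ V y) -> y ∈ z -> x ∈ V z.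
Proof. by move=> h yz; apply/VE; exists y. Qed.

Lemma V_opair x y a b c : x ∈ V a -> y ∈ V a -> a ∈ b -> b ∈ c ->
  opair x y ∈ V c.
Proof.
move=> xa ya ab bc; apply: (V_sub _ bc) => u /upairE[]->.
  by apply: (V_sub _ ab) => v /singE->.
by apply: (V_sub _ ab) => v /upairE[]->.
Qed.

Lemma is_upairE z x y : is_upair z x y <-> z = upair x y.
Proof.
split=> [h|-> u]; last exact: upairE.
by apply: ext => u; rewrite upairE h.
Qed.

Lemma is_opairE p x y : is_opair p x y <-> p = opair x y.
Proof.
have h u : u ∈ opair x y <-> is_upair u x x \/ is_upair u x y.
  by rewrite upairE !is_upairE.
split=> [h'|-> u]; last exact: h.
by apply: ext => u; rewrite h h'.
Qed.

Lemma mapsE f x a : maps f x a <-> opair x a ∈ f.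
Proof.
split=> [[p pf /is_opairE <-]//|h].
by exists (opair x a) => //; exact/is_opairE.
Qed.

(** The graph of [rk] on a transitive set containing [x] witnesses its rank. *)
Lemma is_rank_rk x : is_rank x (rk x).
Proof.
pose d := V (sing x); pose f := rep d (fun y => opair y (rk y)).
have fE y a : maps f y a <-> y ∈ d /\ a = rk y.
  rewrite mapsE repE; last by df.
  split=> [[u [ud /opair_inj[-> ->]]]//|[yd ->]]; by exists y.
exists f; last by apply/fE; split=> //; apply: V_self; exact/singE.
split; first split=> [p|y a b].
- rewrite repE; last by df.
  by move=> [y [_ ->]]; exists y, (rk y); exact/is_opairE.
- by rewrite !fE => -[_ ->] [_ ->].
- move=> y a /fE[yd ->]; split=> [z zy|c].
    by exists (rk z); apply/fE; split=> //; exact: V_trans zy yd.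
  rewrite rkE; split=> [[z [zy h]]|[z [b [zy /fE[_ ->] h]]]].
    exists z, (rk z); split=> //.
    by apply/fE; split=> //; exact: V_trans zy yd.
  by exists z.
Qed.

Lemma is_rankE x a : is_rank x a <-> a = rk x.
Proof.
split=> [[f [ff fr] xa]|->]; last exact: is_rank_rk.
pose P x := forall p, p ∈ f -> p = opair x (snd p) -> snd p = rk x.
suff h z : P z.
  by move/mapsE: xa => xa; have := h x _ xa; rewrite snd_opair; apply.
move: z; apply: (@inductionD1 P) => [|y IH p pf pE]; first by rewrite /P; df.
have ya : maps f y (snd p) by apply/mapsE; rewrite -pE.
have [h1 h2] := fr y _ ya.
apply: ext => c; rewrite h2 rkE; split=> [[z [b [zy zb h]]]|[z [zy h]]].
  exists z; split=> //; move/mapsE: zb => zb.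
  by have := IH z zy _ zb; rewrite snd_opair => <-.
have [b zb] := h1 z zy; exists z, b; split=> //.
by move/mapsE: zb => zb; have := IH z zy _ zb; rewrite snd_opair => ->.
Qed.

Lemma rank_leE x y : rank_le x y <-> rk x ∈ rk y \/ rk x = rk y.
Proof.
split=> [[a [b [/is_rankE-> /is_rankE->]]]//|h].
by exists (rk x), (rk y); split=> //; exact/is_rankE.
Qed.

Lemma rank_ltE x a : rank_lt_ord x a <-> rk x ∈ a.
Proof.
split=> [[b /is_rankE->]//|h]; by exists (rk x) => //; exact/is_rankE.
Qed.

(** Induction for Pi_2 predicates: by Sigma_2-separation the counterexamples in
    a transitive set form a set, which has a minimal element. *)
Lemma inductionP2 (P : M -> Prop) : S2 (fun e => ~ P (e 0)) ->
  (forall x, (forall y, y ∈ x -> P y) -> P x) -> forall x, P x.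
Proof.
move=> hP IH x; pose C := sep (V (sing x)) (fun y => ~ P y).
have CE y : y ∈ C <-> y ∈ V (sing x) /\ ~ P y by exact: sepE2.
suff h y : ~ y ∈ C.
  apply: contrapT => nP; apply: (h x); apply/CE; split=> //.
  by apply: V_self; exact/singE.
move: y; apply: inductionD1 => [|y IHy yC]; first by df.
have [yV nP] := (CE y).1 yC; apply: nP; apply: IH => z zy.
apply: contrapT => nP; apply: (IHy z zy); apply/CE; split=> //.
exact: V_trans zy yV.
Qed.

(** * Back-and-forth types *)

Fixpoint num n : M := if n is k.+1 then sing (num k) else emp.

Lemma num_inj m n : num m = num n -> m = n.
Proof.
have sing_neq x : sing x <> emp.
  by move=> h; apply: (@empE x); rewrite -h; exact/singE.
elim: m n => [|m IH] [|n] //= h; first by case: (@sing_neq (num n)).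
  by case: (@sing_neq (num m)).
congr _.+1; apply: IH.
by apply/singE; rewrite -h; exact/singE.
Qed.

(** Labels of moves: a standard number telling the kind of the move and, for
    observations, what is observed. *)
Definition lab n x := opair (num n) x.

Lemma lab_inj m n x y : lab m x = lab n y -> m = n /\ x = y.
Proof. by move=> /opair_inj[/num_inj]. Qed.

Lemma T1_lab n F : T1 F -> T1 (fun e => lab n (F e)).
Proof. by rewrite /lab => hF; df. Qed.

(** The state [s] is a pair [(x, ((u, v), w))] of an index and a tuple with last
    entries [v] and [w].  An observation is a move that leaves the state
    unchanged and is available when the fact that its label stands for holds.
    The label [lab 9 w] makes [w] itself visible, at levels beyond its rank;
    [lab 10 emp] is always available and only lowers the level. *)
Definition observation s l :=
  let v := snd (fst (snd s)) in let w := snd (snd s) in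
  (l = lab 4 emp /\ v ∈ w) \/ (l = lab 5 emp /\ w ∈ v) \/
  (l = lab 6 emp /\ v = w) \/
  (l = lab 7 emp /\ (rk w ∈ rk v \/ rk w = rk v)) \/
  (l = lab 8 emp /\ w ∈ V (fst s)) \/ l = lab 9 w \/ l = lab 10 emp.

(** The moves: append an element of [V x] to the tuple, forget its last entry,
    forget the last entry but one, restrict the structure to the index given by
    the last entry and forget this entry. *)
Definition step s l s' :=
  (l = lab 0 emp /\ exists x, x ∈ V (fst s) /\
     s' = opair (fst s) (opair (snd s) x)) \/
  (l = lab 1 emp /\ s' = opair (fst s) (fst (snd s))) \/
  (l = lab 2 emp /\
     s' = opair (fst s) (opair (fst (fst (snd s))) (snd (snd s)))) \/
  (l = lab 3 emp /\ snd (snd s) ∈ fst s /\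
     s' = opair (snd (snd s)) (fst (snd s))) \/
  (s' = s /\ observation s l).

(** A set containing the states one move away, which bounds a quantifier in the
    definition of types. *)
Definition successors s :=
  cup (rep (V (fst s)) (fun x => opair (fst s) (opair (snd s) x)))
    (cup (upair (opair (fst s) (fst (snd s)))
            (opair (fst s) (opair (fst (fst (snd s))) (snd (snd s)))))
         (upair (opair (snd (snd s)) (fst (snd s))) s)).

Lemma step_successor s l s' : step s l s' -> s' ∈ successors s.
Proof.
rewrite /successors !cupE !upairE.
move=> [[_ [x [xV ->]]]|[[_ ->]|[[_ ->]|[[_ [_ ->]]|[-> _]]]]]; auto.
by left; apply/repE; [df|exists x].
Qed.

Definition type_pred p :=
  bigU (rep (fst p) (fun d => rep (successors (snd p)) (fun s => opair d s))).

Lemma type_predE p q : q ∈ type_pred p <-> exists d s,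
  [/\ d ∈ fst p, s ∈ successors (snd p) & q = opair d s].
Proof.
rewrite bigUE; split=> [[w []]|[d [s [dp sp ->]]]].
  rewrite repE; last by rewrite /successors; df.
  move=> [d [dp ->]]; rewrite repE; last by df.
  by move=> [s [sp ->]]; exists d, s.
exists (rep (successors (snd p)) (fun s => opair d s)); split.
  by apply/repE; [rewrite /successors; df|exists d].
by apply/repE; [df|exists s].
Qed.

(** Moves may increase the rank of states, but they lower levels: this is an
    induction on the level of a statement about all states, hence a Pi_2
    induction. *)
Lemma type_pred_ind (P : M -> Prop) : S1 (fun e => P (e 0)) ->
  (forall x, (forall y, y ∈ type_pred x -> P y) -> P x) -> forall x, P x.
Proof.
move=> hP IH x; pose Q d := forall p, fst p = d -> P p.
suff h d : Q d by exact: (h (fst x)).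
move: d; apply: (@inductionP2 Q) => [|d IHd p pd].
  exists (fun e => ~ fst (e 0) = e 1 \/ P (e 0)).
    apply: S1_or; first by apply: (_ : D1 _).1; df.
    exact: (S1_subst inl hP).
  move=> e; rewrite /Q -existsNE; split=> -[p h]; exists p.
    by move=> [h'|h'] /=; apply: h.
  by move=> h'; apply: h => /=; have [E|E] := pselect (fst p = e 0); auto.
apply: IH => q /type_predE[d' [s [d'd sp ->]]].
by apply: (IHd d'); rewrite -?pd // fst_opair.
Qed.

(** The elements of a type of level [d] are the [(l, (m, t))] such that a move
    with label [l] leads to a state with type [t] of level [m] in [d]; only those
    of rank below [d] are kept, so that types of level [d] are subsets of
    [V d]. *)
Definition type_step p r := sep (V (fst p)) (fun z => exists q, q ∈ r /\
  (step (snd p) (fst z) (snd (fst q)) /\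
   z = opair (fst z) (opair (fst (fst q)) (snd q)))).

Lemma D1_step F G H : T1 F -> T1 G -> T1 H ->
  D1 (fun e => step (F e) (G e) (H e)).
Proof.
move=> hF hG hH; apply: (D1_app3 (R := step)) => //.
by rewrite /step /observation; df; apply: T1_lab; df.
Qed.

Ltac D1_known ::= match goal with
  | |- D1 (fun e => Ord (@?F e)) => refine (D1_Ord (F := F) _); df
  | |- D1 (fun e => step (@?F e) (@?G e) (@?H e)) =>
      refine (D1_step (F := F) (G := G) (H := H) _ _ _); df
  end.

Lemma types_exist : exists F : M -> M, T1 (fun e => F (e 0)) /\
  forall p, F p = type_step p (rep (type_pred p) (fun q => opair q (F q))).
Proof.
apply: recursion => [||P].
- by rewrite /type_pred /successors; df.
- by rewrite /type_step; df.
- exact: type_pred_ind.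
Qed.

Definition btype d s := projT1 (cid types_exist) (opair d s).

Lemma T1_btype F G : T1 F -> T1 G -> T1 (fun e => btype (F e) (G e)).
Proof.
move=> hF hG; apply: (T1_app (F := fun e => opair (F e) (G e))); last by df.
exact: (projT2 (cid types_exist)).1.
Qed.

Lemma btypeE d s z : z ∈ btype d s <-> z ∈ V d /\ exists m l s',
  [/\ m ∈ d, step s l s' & z = opair l (opair m (btype m s'))].
Proof.
have [hT hE] := projT2 (cid types_exist).
rewrite {1}/btype hE /type_step sepE; last by df.
rewrite fst_opair snd_opair; split=> -[zV].
  move=> [q [+ [st zE]]]; rewrite repE; last by df.
  move=> [p [/type_predE[m [s' [md _ ->]]] qE]]; split=> //.
  exists m, (fst z), s'; move: st zE.
  by rewrite qE !fst_opair !snd_opair; rewrite fst_opair in md.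
move=> [m [l [s' [md st zE]]]]; split=> //.
exists (opair (opair m s') (btype m s')).
rewrite zE !fst_opair !snd_opair; split=> //.
apply/repE; first by df.
exists (opair m s'); split=> //; apply/type_predE; exists m, s'.
by rewrite fst_opair snd_opair; split=> //; exact: step_successor st.
Qed.

Ltac T1_types := match goal with
  | |- T1 (fun e => btype (@?F e) (@?G e)) =>
      refine (T1_btype (F := F) (G := G) _ _); df
  end.
Ltac T1_known ::=
  first [T1_hyps | T1_pairs | T1_projections | T1_ranks | T1_types].

Lemma btype_sub d s : btype d s ∈ pow (V d).
Proof. by apply/powE => z /btypeE[]. Qed.

(** Five steps of membership leave enough room for [(l, (m, t))] to have rank
    below [d] whenever [l] and [t] have rank at most that of [m]. *)
Definition far m d := Ord d /\ exists a b c f,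
  [/\ m ∈ a, a ∈ b, b ∈ c & c ∈ f /\ f ∈ d].

Lemma far_elt m d : far m d -> m ∈ d.
Proof.
move=> [od [a [b [c [f [ma ab bc [cf fd]]]]]]].
have t x y := @Ord_trans d x y od.
exact/(t _ _ ma)/(t _ _ ab)/(t _ _ bc)/(t _ _ cf).
Qed.

Lemma far_mono m d d' : far m d -> Ord d' -> d ∈ d' \/ d = d' -> far m d'.
Proof.
move=> md od' [dd'|<-] //; split=> //.
have [_ [a [b [c [f [ma ab bc [cf fd]]]]]]] := md.
exists a, b, c, f; split=> //; split=> //; exact: Ord_trans fd dd'.
Qed.

(** Equality of types is a bisimulation: a move on one side can be answered on
    the other side, at any level far below. *)
Lemma btype_step d m s t l s' : far m d -> btype d s = btype d t -> l ∈ V m ->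
  step s l s' -> exists t', step t l t' /\ btype m s' = btype m t'.
Proof.
move=> md E lm st; have md' := far_elt md.
have [_ [a [b [c [f [ma ab bc [cf fd]]]]]]] := md.
have : opair l (opair m (btype m s')) ∈ btype d s.
  apply/btypeE; split; last by exists m, l, s'.
  apply: (V_opair _ _ cf fd).
    exact: V_mono (V_mono (V_mono lm ma) ab) bc.
  apply: (V_opair _ _ ab bc); first exact: V_self.
  by apply: (V_sub _ ma); exact/powE/btype_sub.
rewrite E => /btypeE[_ [m' [l' [t' [_ tt' /opair_inj[-> /opair_inj[-> ->]]]]]]].
by exists t'.
Qed.

Lemma observation_cases s n x : observation s (lab n x) ->
  let v := snd (fst (snd s)) in let w := snd (snd s) in
  match n with
  | 4 => v ∈ w
  | 5 => w ∈ v
  | 6 => v = w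
  | 7 => rk w ∈ rk v \/ rk w = rk v
  | 8 => w ∈ V (fst s)
  | 9 => x = w
  | 10 => True
  | _ => False
  end.
Proof.
by case=> [[/lab_inj[->]]|[[/lab_inj[->]]|[[/lab_inj[->]]|[[/lab_inj[->]]|
  [[/lab_inj[->]]|[/lab_inj[->]|/lab_inj[->]]]]]]].
Qed.

Lemma step_cases s n x s' : step s (lab n x) s' ->
  match n with
  | 0 => exists y, y ∈ V (fst s) /\ s' = opair (fst s) (opair (snd s) y)
  | 1 => s' = opair (fst s) (fst (snd s))
  | 2 => s' = opair (fst s) (opair (fst (fst (snd s))) (snd (snd s)))
  | 3 => snd (snd s) ∈ fst s /\ s' = opair (snd (snd s)) (fst (snd s))
  | _ => s' = s /\ observation s (lab n x)
  end.
Proof.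
case=> [[/lab_inj[->]]|[[/lab_inj[->]]|[[/lab_inj[->]]|[[/lab_inj[->]]|]]]] //.
by case=> [->] /[dup] /observation_cases; case: n => [|[|[|[|n]]]].
Qed.

(** * The cut *)

Section Cut.
Variable S : set M.
Hypothesis hS : rank_cut_of S.

Lemma S_initial s x : S s -> rk x ∈ rk s \/ rk x = rk s -> S x.
Proof.
move=> Ss /rank_leE xs.
by have [[y Sy] _ <-] := hS.1.2 (exist _ s Ss) x xs.
Qed.

(** The ordinals outside the cut serve as levels: by toplessness they contain
    infinite descending sequences. *)
Definition outside d := Ord d /\ ~ S d.

Lemma outside_descent d : outside d -> exists m, outside m /\ m ∈ d.
Proof.
move=> [od nSd].
have [|g' [og' nS g'd]] := hS.2.2 d od.
  by move=> [[y Sy] _ E]; apply: nSd; rewrite -E.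
by exists g'; split=> //; split=> // Sg'; apply: nS; exists (exist _ g' Sg').
Qed.

Lemma outside_exists : exists d, outside d.
Proof.
have [[g og hg] _] := hS.2; exists g; split=> // Sg.
have /hg : range (@proj1_sig M S) g by exists (exist _ g Sg).
by move=> /rank_ltE; rewrite rk_Ord // => /elt_irrefl.
Qed.

Lemma S_V s d : outside d -> S s -> s ∈ V d.
Proof.
move=> [od nSd] Ss; apply/V_Ord => //; apply: contrapT => sd; apply: nSd.
apply: (S_initial Ss); rewrite rk_Ord //.
by case: (Ord_total (Ord_rk s) od) => // h; auto.
Qed.

Definition below_outside m d := outside m /\ far m d.

Lemma below_outside_exists d : outside d -> exists m, below_outside m d.
Proof.
move=> hd; have [f [hf fd]] := outside_descent hd.
have [c [hc cf]] := outside_descent hf.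
have [b [hb bc]] := outside_descent hc.
have [a [ha ab]] := outside_descent hb.
have [m [hm ma]] := outside_descent ha.
by exists m; split=> //; split; [exact: hd.1|exists a, b, c, f].
Qed.

(** The labels that are visible at all levels outside the cut. *)
Definition small x := forall d, outside d -> x ∈ V d.

Lemma small_lab n x : small x -> small (lab n x).
Proof.
move=> sx d hd; have [f [hf fd]] := outside_descent hd.
have [c [hc cf]] := outside_descent hf.
apply: (V_opair _ (sx c hc) cf fd).
elim: n c hc {cf} => [|n IH] c hc; have [m [hm mc]] := outside_descent hc.
  by apply: (V_sub _ mc) => u /empE.
by apply: (V_sub _ mc) => u /singE->; exact: IH.
Qed.

Lemma small_emp : small emp.
Proof.
move=> d /outside_descent[m [_ md]].
by apply: (V_sub _ md) => u /empE.
Qed.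

Lemma small_S s : S s -> small s.
Proof. by move=> Ss d hd; exact: S_V. Qed.

Lemma btype_lab d m s t n s' : below_outside m d -> btype d s = btype d t ->
  step s (lab n emp) s' ->
  exists t', step t (lab n emp) t' /\ btype m s' = btype m t'.
Proof.
move=> [om md] E; apply: (btype_step md E).
exact: (small_lab n small_emp om).
Qed.

Lemma btype_add d m x a z b u : below_outside m d ->
  btype d (opair x a) = btype d (opair z b) -> u ∈ V x -> exists w, w ∈ V z /\
  btype m (opair x (opair a u)) = btype m (opair z (opair b w)).
Proof.
move=> md E ux; have [|t' [/step_cases[w]]] :=
    btype_lab (n := 0) md E (s' := opair x (opair a u)).
  by left; split=> //; exists u; rewrite fst_opair snd_opair.
by rewrite fst_opair snd_opair => -[wz ->] ?; exists w.
Qed.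

Lemma btype_fst d m x a z b u w : below_outside m d ->
  btype d (opair x (opair a u)) = btype d (opair z (opair b w)) ->
  btype m (opair x a) = btype m (opair z b).
Proof.
move=> md E.
have [|t' [/step_cases->]] := btype_lab (n := 1) md E (s' := opair x a).
  by right; left; rewrite !(fst_opair, snd_opair).
by rewrite !(fst_opair, snd_opair).
Qed.

Lemma btype_drop d m x a z b u w u' w' : below_outside m d ->
  btype d (opair x (opair (opair a u) u')) =
  btype d (opair z (opair (opair b w) w')) ->
  btype m (opair x (opair a u')) = btype m (opair z (opair b w')).
Proof.
move=> md E.
have [|t' [/step_cases->]] := btype_lab (n := 2) md E (s' := opair x (opair a u')).
  by right; right; left; rewrite !(fst_opair, snd_opair).
by rewrite !(fst_opair, snd_opair).
Qed.

Lemma btype_target d m x a z b u w : below_outside m d ->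
  btype d (opair x (opair a u)) = btype d (opair z (opair b w)) -> u ∈ x ->
  w ∈ z /\ btype m (opair u a) = btype m (opair w b).
Proof.
move=> md E ux.
have [|t' [/step_cases]] := btype_lab (n := 3) md E (s' := opair u a).
  by right; right; right; left; rewrite !(fst_opair, snd_opair).
by rewrite !(fst_opair, snd_opair) => -[wz ->].
Qed.

Lemma btype_obs d s t n x : outside d -> btype d s = btype d t -> small x ->
  observation s (lab n x) -> observation t (lab n x).
Proof.
move=> hd E sx so; have [m [om md]] := below_outside_exists hd.
have [|t' [/step_cases]] := btype_step md E (small_lab n sx om) (s' := s).
  by do 4 right.
by move: (observation_cases so); case: n so => [|[|[|[|n]]]] // _ _ [].
Qed.

(** Restricting the structure is a composite move: the new index is first
    appended to the tuple. *)
Lemma btype_restrict d m1 m x a z b u : below_outside m1 d -> below_outside m m1 ->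
  Ord x -> btype d (opair x a) = btype d (opair z b) -> u ∈ x ->
  exists w, w ∈ z /\ btype m (opair u a) = btype m (opair w b).
Proof.
move=> m1d mm1 ox E ux; have [|w [_ E']] := btype_add m1d E (u := u).
  exact: V_self.
by exists w; exact: btype_target mm1 E' ux.
Qed.

Lemma btype_skip d m s t : below_outside m d ->
  btype d s = btype d t -> btype m s = btype m t.
Proof.
move=> md E; have [|t' [/step_cases[-> _]]] // :=
  btype_lab (n := 10) md E (s' := s).
by do 4 right; split=> //; do 6 right.
Qed.

(** * Finite partial maps and their invariant *)

Definition code1 (l : seq (M * M)) := foldr (fun p c => opair c p.1) emp l.
Definition code2 (l : seq (M * M)) := foldr (fun p c => opair c p.2) emp l.

(** Each entry can be made the last one, by forgetting the entries added after
    it; similarly below, for two entries. *)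
Lemma btype_last d x z l p : outside d -> List.In p l ->
  btype d (opair x (code1 l)) = btype d (opair z (code2 l)) ->
  exists m u w, outside m /\
    btype m (opair x (opair u p.1)) = btype m (opair z (opair w p.2)).
Proof.
elim: l d => //= q l IH d hd [->|pl] E.
  by exists d, (code1 l), (code2 l).
have [m md] := below_outside_exists hd.
exact: (IH m md.1 pl (btype_fst md E)).
Qed.

Lemma btype_last2 d x z l p u w : outside d -> List.In p l ->
  btype d (opair x (opair (code1 l) u)) = btype d (opair z (opair (code2 l) w)) ->
  exists m a b, outside m /\
    btype m (opair x (opair (opair a p.1) u)) =
    btype m (opair z (opair (opair b p.2) w)).
Proof.
elim: l d => //= q l IH d hd [->|pl] E.
  by exists d, (code1 l), (code2 l).
have [m md] := below_outside_exists hd.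
exact: (IH m md.1 pl (btype_drop md E)).
Qed.

(** The element [a] of the cut is visible as a label. *)
Lemma btype_fixes d x z l a b : outside d -> List.In (a, b) l ->
  btype d (opair x (code1 l)) = btype d (opair z (code2 l)) -> S a -> a = b.
Proof.
move=> hd /(btype_last hd) h /h{h}[m [u [w [hm E]]]] Sa.
have /observation_cases /= : observation (opair z (opair w b)) (lab 9 a).
  apply: (btype_obs hm E (small_S Sa)).
  by do 5 right; left; rewrite !(fst_opair, snd_opair).
by rewrite !(fst_opair, snd_opair).
Qed.

Lemma btype_domain d x z l a b : outside d -> List.In (a, b) l ->
  btype d (opair x (code1 l)) = btype d (opair z (code2 l)) ->
  a ∈ V x -> b ∈ V z.
Proof.
move=> hd /(btype_last hd) h /h{h}[m [u [w [hm E]]]] ax.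
have /observation_cases /= : observation (opair z (opair w b)) (lab 8 emp).
  apply: (btype_obs hm E small_emp).
  by do 4 right; left; rewrite !(fst_opair, snd_opair).
by rewrite !(fst_opair, snd_opair).
Qed.

(** What is needed of two entries of the tuples for the union of the partial
    maps to be an embedding, and for [back] to control ranks. *)
Definition alike a u b w := [/\ a ∈ u <-> b ∈ w, u ∈ a <-> w ∈ b,
  a = u <-> b = w & (rk u ∈ rk a \/ rk u = rk a) <->
    (rk w ∈ rk b \/ rk w = rk b)].

Lemma btype_alike d x z a u b w a' b' : outside d ->
  btype d (opair x (opair (opair a' a) u)) =
  btype d (opair z (opair (opair b' b) w)) -> alike a u b w.
Proof.
suff h x0 z0 a1 u1 b1 w1 a'1 b'1 : outside d ->
    btype d (opair x0 (opair (opair a'1 a1) u1)) =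
    btype d (opair z0 (opair (opair b'1 b1) w1)) ->
    [/\ a1 ∈ u1 -> b1 ∈ w1, u1 ∈ a1 -> w1 ∈ b1, a1 = u1 -> b1 = w1 &
       (rk u1 ∈ rk a1 \/ rk u1 = rk a1) ->
       (rk w1 ∈ rk b1 \/ rk w1 = rk b1)].
  move=> hd E; have [h1 h2 h3 h4] := h _ _ _ _ _ _ _ _ hd E.
  by have [g1 g2 g3 g4] := h _ _ _ _ _ _ _ _ hd (esym E).
move=> hd E.
have obs n := fun h => observation_cases (btype_obs (n := n) hd E small_emp h).
rewrite /observation !(fst_opair, snd_opair) in obs.
split=> h1.
- by apply: (obs 4); left.
- by apply: (obs 5); right; left.
- by apply: (obs 6); do 2 right; left.
- by apply: (obs 7); do 3 right; left.
Qed.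

(** The entry added first is on the left in [alike], whence the two cases. *)
Lemma btype_pairs d x z l p q : outside d -> List.In p l -> List.In q l ->
  btype d (opair x (code1 l)) = btype d (opair z (code2 l)) ->
  alike p.1 q.1 p.2 q.2 \/ alike q.1 p.1 q.2 p.2.
Proof.
elim: l d => //= r l IH d hd pl ql E.
have [m md] := below_outside_exists hd.
case: pl => [pE|pl]; case: ql => [qE|ql].
- left; rewrite -pE -qE.
  have irr := @elt_irrefl.
  by split; split=> h //; [case: (irr _ h)|case: (irr _ h)|case: (irr _ h)|
    case: (irr _ h)|right|right].
- right; rewrite -pE; have [n [a [b [hn]]]] := btype_last2 hd ql E.
  exact: btype_alike.
- left; rewrite -qE; have [n [a [b [hn]]]] := btype_last2 hd pl E.
  exact: btype_alike.
- exact: (IH m md.1 pl ql (btype_fst md E)).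
Qed.

(** All ordinals [x] on the left, only those below [beta] on the right: this is
    what puts the range of the embedding below [beta]. *)
Definition transfers d beta a b := forall x, Ord x ->
  exists z, z ∈ beta /\ btype d (opair x a) = btype d (opair z b).

(** Suppose that each candidate [i] failed, at level [m], for some index.  The
    indices of failure are collected and an ordinal [x] above all of them is
    taken; the candidate that succeeds at [x] at level [d] then succeeds, after
    restriction, at its own index of failure.  The threshold [x0] allows the
    hypothesis to be checked only for large indices. *)
Lemma transfers_uniform d m1 m D x0 (fa fb fc : M -> M) :
  T1 (fun e => fa (e 0)) -> T1 (fun e => fb (e 0)) -> T1 (fun e => fc (e 0)) ->
  below_outside m1 d -> below_outside m m1 -> 
  (forall i, i ∈ D -> Ord (fc i)) ->
  (forall x, Ord x -> x0 ∈ V x -> exists i, i ∈ D /\ exists z, z ∈ fc i /\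
     btype d (opair x (fa i)) = btype d (opair z (fb i))) ->
  exists i, i ∈ D /\ transfers m (fc i) (fa i) (fb i).
Proof.
move=> fa1 fb1 fc1 m1d mm1 oc h; apply: contrapT => nh.
have [| |Y hY] := @collection (fun x i => Ord x /\
  ~ exists z, z ∈ fc i /\ btype m (opair x (fa i)) = btype m (opair z (fb i))) D.
- by apply: (_ : D1 _).1; df.
- move=> i iD; apply: contrapT => h'; apply: nh; exists i; split=> // x ox.
  by apply: contrapT => h''; apply: h'; exists x.
have [|i [iD [z [zc E]]]] := h (rk (cup Y (sing x0))) (Ord_rk _).
  apply/V_Ord; first exact: Ord_rk.
  by apply/rk_elt/cupE; right; exact/singE.
have [x [xY [ox nx]]] := hY i iD; apply: nx.
have [|w [wz E']] := btype_restrict m1d mm1 (Ord_rk _) E (u := x).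
  by rewrite -(rk_Ord ox); apply/rk_elt/cupE; left.
by exists w; split=> //; exact: Ord_trans (oc i iD) wz zc.
Qed.

(** The answer to appending [u] lies in some [V z] with [z] in [beta], so the
    candidates are the elements of [V beta]. *)
Lemma forth d m1 m2 m beta a b u : below_outside m1 d -> below_outside m2 m1 ->
  below_outside m m2 -> Ord beta -> transfers d beta a b ->
  exists w, transfers m beta (opair a u) (opair b w).
Proof.
move=> m1d m2m1 mm2 ob h.
have [|||||w [_ hw]] := @transfers_uniform m1 m2 m (V beta) u (fun=> opair a u)
  (fun w => opair b w) (fun=> beta) _ _ _ m2m1 mm2.
- by df.
- by df.
- by df.
- by [].
- move=> x ox ux; have [z [zb E]] := h x ox.
  have [w [wz E']] := btype_add m1d E ux.
  exists w; split; last by exists z.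
  exact: V_mono wz zb.
by exists w.
Qed.

(** The bound on the rank of [w] has two uses: [w] may be played in [V z] because
    [b] belongs to [V z], and the answer has at most the rank of [a], so the
    candidates form a set independent of the index. *)
Lemma back d m1 m2 m beta l a b w : outside d -> below_outside m1 d ->
  below_outside m2 m1 -> below_outside m m2 -> Ord beta ->
  transfers d beta (code1 l) (code2 l) -> List.In (a, b) l ->
  rk w ∈ rk b \/ rk w = rk b ->
  exists u, transfers m beta (opair (code1 l) u) (opair (code2 l) w).
Proof.
move=> hd m1d m2m1 mm2 ob h ab wb.
have [|||||u [_ hu]] := @transfers_uniform m1 m2 m (pow (V a)) a
  (fun u => opair (code1 l) u) (fun=> opair (code2 l) w) (fun=> beta)
  _ _ _ m2m1 mm2.
- by df.
- by df.
- by df.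
- by [].
- move=> x ox ax; have [z [zb E]] := h x ox.
  have oz := Ord_elt ob zb.
  have bz := btype_domain hd ab E ax.
  have wz : w ∈ V z.
    apply/V_Ord => //; move/(V_Ord _ oz): bz => bz.
    by case: wb => [wb|->//]; exact: Ord_trans wb bz.
  have [u [ux E']] := btype_add m1d (esym E) wz.
  exists u; split; last by exists z.
  have [n [a' [b' [hn E'']]]] := btype_last2 m1d.1 ab (esym E').
  have [_ _ _ [_ /(_ wb) ua]] := btype_alike hn E''.
  apply/powE => v vu; apply/V_rk; move: (rk_elt vu).
  by case: ua => [ua|->//] vu'; exact: Ord_trans (Ord_rk a) vu' ua.
by exists u.
Qed.

(** The candidates are the ordinals below [beta].  The one that works at [x] is
    the index [z] provided by the invariant at an ordinal above [x]: restricting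
    to [x] gives an index below [z]. *)
Lemma shrink d m1 m2 m3 m beta a b : below_outside m1 d ->
  below_outside m2 m1 -> below_outside m3 m2 -> below_outside m m3 ->
  Ord beta -> transfers d beta a b -> exists c, c ∈ beta /\ transfers m c a b.
Proof.
move=> m1d m2m1 m3m2 mm3 ob h.
apply: (@transfers_uniform m2 m3 m beta emp (fun=> a) (fun=> b) id) => //.
- by df.
- by df.
- by df.
- by move=> i; exact: Ord_elt.
- move=> x ox _; have osx : Ord (rk (sing x)) by exact: Ord_rk.
  have xsx : x ∈ rk (sing x).
    by rewrite -{1}(rk_Ord ox); apply/rk_elt/singE.
  have [z [zb E]] := h _ osx.
  have [w [wz E']] := btype_restrict m1d m2m1 osx E xsx.
  by exists z; split=> //; exists w.
Qed.

(** The types of level [d] realised by the tuple [a] form a set, by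
    Sigma_1-separation, and collection bounds indices realising them. *)
Lemma start d a : outside d -> exists beta, Ord beta /\ transfers d beta a a.
Proof.
move=> hd.
pose W := sep (pow (V d)) (fun t => exists x, Ord x /\ btype d (opair x a) = t).
have WE t : t ∈ W <->
    t ∈ pow (V d) /\ exists x, Ord x /\ btype d (opair x a) = t.
  apply/sepE2/S2_S1.
  apply: (S1_ex (Q := fun x e => Ord x /\ btype d (opair x a) = e 0)).
  by apply: (_ : D1 _).1; df.
have [| |Y hY] := @collection (fun x t => Ord x /\ btype d (opair x a) = t) W.
- by apply: (_ : D1 _).1; df.
- by move=> t /WE[].
exists (rk Y); split=> [|x ox]; first exact: Ord_rk.
have [|z [zY [oz E]]] := hY (btype d (opair x a)).
  by apply/WE; split; [exact: btype_sub|exists x].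
by exists z; split=> //; rewrite -(rk_Ord oz); exact: rk_elt.
Qed.

(** Filling up a subset of [V k] with all elements of [V x0] outside [V k] gives
    a set of rank exactly [x0] that still determines the subset. *)
Lemma rk_trace k x0 x : Ord x0 -> k ∈ x0 ->
  rk (sep (V x0) (fun y => y ∈ V k -> y ∈ x)) = x0.
Proof.
move=> o0 kx0; have ok := Ord_elt o0 kx0; set z := sep _ _.
have zE y : y ∈ z <-> y ∈ V x0 /\ (y ∈ V k -> y ∈ x).
  by apply: sepE; df.
have mem y : y ∈ x0 -> k ∈ y \/ k = y -> y ∈ rk z.
  move=> yx0 ky; have oy := Ord_elt o0 yx0.
  rewrite -(rk_Ord oy); apply/rk_elt/zE; split; first exact: V_self.
  move=> /(V_Ord _ ok); rewrite (rk_Ord oy) => yk; case: ky => [ky|E].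
    by case: (@elt_irrefl k); exact: Ord_trans ky yk.
  by rewrite E in yk; case: (elt_irrefl yk).
have [|zx|//] := @rk_sub z x0 o0.
  by move=> y /zE[/(V_Ord _ o0)].
case: (Ord_total ok (Ord_rk z)) => [h|h|h].
- by case: (@elt_irrefl (rk z)); apply: mem => //; left.
- by case: (@elt_irrefl (rk z)); apply: mem => //; right.
- have := mem k kx0 (or_intror erefl) => /(Ord_trans ok)/(_ h).
  by move=> /elt_irrefl.
Qed.

(** The set of the types realised by [(a, u)] is a subset of [pow (V d)], hence
    an element of [V k].  There are at least as many sets of rank [x0] as subsets
    of [V k], so two of them are assigned the same element of [V k]. *)
Lemma same_types d x0 a k1 k : Ord x0 -> d ∈ k1 -> k1 ∈ k -> k ∈ x0 ->
  exists u w, [/\ rk u = x0, rk w = x0, u <> w &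
    forall x, Ord x -> exists y, Ord y /\
      btype d (opair x (opair a u)) = btype d (opair y (opair a w))].
Proof.
move=> o0 dk1 k1k kx0.
(* Realising a type is only a Sigma_1 relation; restricted to the set Z it
   becomes a set R, in terms of which the types realised are given by a
   Delta_1 function. *)
pose Z := bigU (rep (pow (V x0)) (fun u =>
  rep (pow (V d)) (fun t => opair u t))).
have ZE u t : u ∈ pow (V x0) -> t ∈ pow (V d) -> opair u t ∈ Z.
  move=> ux td; apply/bigUE; exists (rep (pow (V d)) (fun t => opair u t)).
  by split; apply/repE; [df|exists u|df|exists t].
pose R := sep Z (fun q => exists x, Ord x /\
  btype d (opair x (opair a (fst q))) = snd q).
have RE q : q ∈ R <-> q ∈ Z /\ exists x, Ord x /\
    btype d (opair x (opair a (fst q))) = snd q.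
  apply/sepE2/S2_S1.
  apply: (S1_ex (Q := fun x e => Ord x /\
    btype d (opair x (opair a (fst (e 0)))) = snd (e 0))).
  by apply: (_ : D1 _).1; df.
pose W u := sep (pow (V d)) (fun t => opair u t ∈ R).
have WE u t : t ∈ W u <-> t ∈ pow (V d) /\ opair u t ∈ R.
  by apply: sepE; df.
pose z x := sep (V x0) (fun y => y ∈ V k -> y ∈ x).
have zE x y : y ∈ z x <-> y ∈ V x0 /\ (y ∈ V k -> y ∈ x).
  by apply: sepE; df.
have [| |x [y [/powE xk /powE yk xy E]]] := @cantor (fun x => W (z x)) (V k).
- by rewrite /W /z; df.
- move=> x _; apply: (V_sub _ k1k) => t /WE[/powE td _].
  exact: (V_sub _ dk1).
have zx x' : z x' ∈ pow (V x0) by apply/powE => v /zE[].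
exists (z x), (z y); split; [exact: rk_trace|exact: rk_trace| |].
  move=> zxy; apply: xy; apply: ext => v; split=> [vx|vy].
    have : v ∈ z x by apply/zE; split=> //; exact: V_mono (xk v vx) kx0.
    by rewrite zxy => /zE[_]; apply; exact: xk.
  have : v ∈ z y by apply/zE; split=> //; exact: V_mono (yk v vy) kx0.
  by rewrite -zxy => /zE[_]; apply; exact: yk.
move=> v ov; pose t := btype d (opair v (opair a (z x))).
have : t ∈ W (z x).
  apply/WE; split; first exact: btype_sub.
  apply/RE; split; first by apply: ZE => //; exact: btype_sub.
  by exists v; rewrite fst_opair snd_opair.
rewrite E => /WE[_ /RE[_ [y' [oy']]]]; rewrite fst_opair snd_opair => E'.
by exists y'.
Qed.

(** * The construction *)

Lemma far_exists d : outside d -> exists m1 m2 m3,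
  [/\ below_outside m1 d, below_outside m2 m1 & below_outside m3 m2].
Proof.
move=> hd; have [m1 h1] := below_outside_exists hd.
have [m2 h2] := below_outside_exists h1.1.
have [m3 h3] := below_outside_exists h2.1.
by exists m1, m2, m3.
Qed.

(** The conditions of the construction: a finite partial map, a level and a bound
    for the range. *)
Definition condition (l : seq (M * M)) d beta :=
  [/\ outside d, Ord beta & transfers d beta (code1 l) (code2 l)].

Definition extends (l l' : seq (M * M)) (beta beta' : M) :=
  (forall p, List.In p l -> List.In p l') /\ (beta' ∈ beta \/ beta' = beta).

Lemma extends_trans l l' l'' beta beta' beta'' : Ord beta ->
  extends l l' beta beta' -> extends l' l'' beta' beta'' ->
  extends l l'' beta beta''.
Proof.
move=> ob [ll' bb'] [l'l'' b'b'']; split=> [p /ll' /l'l''//|].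
case: b'b'' => [h|->//]; left.
by case: bb' => [h'|<-//]; exact: Ord_trans h h'.
Qed.

Lemma condition_fixes l d beta a b : condition l d beta -> List.In (a, b) l ->
  S a -> a = b.
Proof.
move=> [hd ob h] ab Sa; have [z [zb E]] := h (rk a) (Ord_rk a).
exact: btype_fixes hd ab E Sa.
Qed.

Lemma condition_range l d beta a b : condition l d beta -> List.In (a, b) l ->
  b ∈ V beta.
Proof.
move=> [hd ob h] ab; have [z [zb E]] := h (rk (sing a)) (Ord_rk _).
apply: V_mono zb; apply: (btype_domain hd ab E).
by apply/V_Ord; [exact: Ord_rk|apply/rk_elt/singE].
Qed.

Lemma condition_alike l d beta p q : condition l d beta ->
  List.In p l -> List.In q l ->
  alike p.1 q.1 p.2 q.2 \/ alike q.1 p.1 q.2 p.2.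
Proof.
move=> [hd ob h] pl ql; have [z [zb E]] := h (rk p.1) (Ord_rk _).
exact: btype_pairs hd pl ql E.
Qed.

Lemma dense_forth l d beta u : condition l d beta -> exists w l' d' beta',
  [/\ condition l' d' beta', extends l l' beta beta' & List.In (u, w) l'].
Proof.
move=> [hd ob h]; have [m1 [m2 [m3 [h1 h2 h3]]]] := far_exists hd.
have [w hw] := forth u h1 h2 h3 ob h.
exists w, ((u, w) :: l), m3, beta; split; last by left.
- by split=> //; exact: h3.1.
- by split=> [p|]; right.
Qed.

Lemma dense_back l d beta a b w : condition l d beta -> List.In (a, b) l ->
  rk w ∈ rk b \/ rk w = rk b -> exists u l' d' beta',
  [/\ condition l' d' beta', extends l l' beta beta' & List.In (u, w) l'].
Proof.
move=> [hd ob h] ab wb; have [m1 [m2 [m3 [h1 h2 h3]]]] := far_exists hd.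
have [u hu] := back hd h1 h2 h3 ob h ab wb.
exists u, ((u, w) :: l), m3, beta; split; last by left.
- by split=> //; exact: h3.1.
- by split=> [p|]; right.
Qed.

(** Either [g] can serve as a bound and be lowered, or some ordinal [x0] shows
    that it cannot; in the latter case the image of [x0] is an ordinal at least
    [g], because restriction to [x0] would otherwise give an index below [g]. *)
Lemma dense_topless l d beta g : condition l d beta -> Ord g ->
  exists l' d' beta', [/\ condition l' d' beta', extends l l' beta beta' &
    (exists p, List.In p l' /\ (rk g ∈ rk p.2 \/ rk g = rk p.2)) \/
    beta' ∈ g].
Proof.
move=> c og; have [hd ob h] := c.
have [m1 [m2 [m3 [h1 h2 h3]]]] := far_exists hd.
(* The level m5 of the test lies below the level m3 reached by [forth]. *)
have [m4 [m5 [m6 [h4 h5 h6]]]] := far_exists h3.1.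
have [m7 [m8 [m9 [h7 h8 h9]]]] := far_exists h6.1.
have [bg|bg] := pselect (beta ∈ g).
  exists l, d, beta; split; [by []| |by right].
  by split=> //; right.
have gb : g ∈ beta \/ g = beta.
  by case: (Ord_total og ob) => //; auto.
have [hg|hg] := pselect (transfers m5 g (code1 l) (code2 l)).
  have [g' [g'g hg']] := shrink h6 h7 h8 h9 og hg.
  exists l, m9, g'; split; last by right.
  - by split=> //; [exact: h9.1|exact: Ord_elt g'g].
  - split=> //; left; case: gb => [gb|<-//]; exact: Ord_trans g'g gb.
have [x0 [o0 nx0]] : exists x0, Ord x0 /\ ~ exists z, z ∈ g /\
    btype m5 (opair x0 (code1 l)) = btype m5 (opair z (code2 l)).
  apply: contrapT => nx; apply: hg => x ox; apply: contrapT => nz.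
  by apply: nx; exists x.
have [w hw] := forth x0 h1 h2 h3 ob h.
exists ((x0, w) :: l), m3, beta; split.
- by split=> //; exact: h3.1.
- by split=> [p|]; right.
left; exists (x0, w); split; first by left.
have xs : x0 ∈ rk (sing x0) by rewrite -{1}(rk_Ord o0); apply/rk_elt/singE.
have [z [zb E]] := hw _ (Ord_rk (sing x0)).
have [wz E'] := btype_target h4 E xs.
have ow : Ord w by exact: Ord_elt (Ord_elt ob zb) wz.
rewrite !rk_Ord //.
have nwg : ~ w ∈ g.
  by move=> wg; apply: nx0; exists w; split=> //; exact: btype_skip h5 E'.
by case: (Ord_total og ow); auto.
Qed.

(** Two elements realising the same types have the same admissible images; an
    image of both differs from one of them. *)
Lemma dense_move l d beta x0 : condition l d beta -> outside x0 ->
  exists l' d' beta', [/\ condition l' d' beta', extends l l' beta beta' &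
    exists p, [/\ List.In p l', rk p.1 = x0 & p.1 <> p.2]].
Proof.
move=> [hd ob h] h0.
(* A level lying below both the current one and x0. *)
have [c0 [he ed e0]] : exists c0, [/\ outside c0, c0 ∈ d \/ c0 = d &
    c0 ∈ x0 \/ c0 = x0].
  case: (Ord_total hd.1 h0.1) => dx0; last by exists x0; split; auto.
    by exists d; split; auto.
  by exists d; split; auto.
have [m1 [m2 [m3 [h1 h2 h3]]]] := far_exists he.
have h1' : below_outside m1 d.
  by split; [exact: h1.1|exact: far_mono h1.2 hd.1 ed].
have [_ [k1 [k [c [f [k1m ka ac [cf fm2]]]]]]] := h3.2.
have mx0 m : m ∈ m1 -> m ∈ x0.
  move=> mm1; have me := Ord_trans he.1 mm1 (far_elt h1.2).
  by case: e0 => [e0|<-//]; exact: Ord_trans h0.1 me e0.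
have kx0 : k ∈ x0.
  have km2 := Ord_trans h2.1.1 ac (Ord_trans h2.1.1 cf fm2).
  by apply: mx0; exact: Ord_trans h1.1.1 km2 (far_elt h2.2).
have [u [u' [ux0 u'x0 uu' hu]]] := same_types (code1 l) h0.1 k1m ka kx0.
have [w hw] := forth u' h1' h2 h3 ob h.
(* For each x the type of (x, (a, u)) is one of those realised by (a, u'). *)
have hw' : transfers m3 beta (opair (code1 l) u) (opair (code2 l) w).
  by move=> x /hu[y [oy ->]]; exact: hw.
have add v : rk v = x0 -> v <> w -> transfers m3 beta (opair (code1 l) v)
    (opair (code2 l) w) -> exists l' d' beta',
  [/\ condition l' d' beta', extends l l' beta beta' &
    exists p, [/\ List.In p l', rk p.1 = x0 & p.1 <> p.2]].
  move=> vx0 vw hv; exists ((v, w) :: l), m3, beta; split.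
  - by split=> //; exact: h3.1.
  - by split=> [p|]; right.
  - by exists (v, w); split=> //; left.
have [uw|uw] := pselect (u = w); last exact: add uw hw'.
by apply: add hw => // u'w; apply: uu'; rewrite uw.
Qed.

(** What the stage devoted to the pair [(x, y)] achieves.  [y] is put in the range
    only if its rank is at most that of the image of [x], and all [x] are tried;
    [x] also serves as the ordinal of the last two clauses. *)
Definition handled (l : seq (M * M)) (beta x y : M) := exists b,
  [/\ List.In (x, b) l,
      rk y ∈ rk b \/ rk y = rk b -> exists a, List.In (a, y) l,
      Ord x -> (exists p, List.In p l /\ (rk x ∈ rk p.2 \/ rk x = rk p.2)) \/
        beta ∈ x &
      outside x -> exists p, [/\ List.In p l, rk p.1 = x & p.1 <> p.2]].

Lemma dense l d beta x y : condition l d beta -> exists l' d' beta',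
  [/\ condition l' d' beta', extends l l' beta beta' & handled l' beta' x y].
Proof.
move=> c0; have [b [l1 [d1 [b1 [c1 e1 xb]]]]] := dense_forth x c0.
have [l2 [d2 [b2 [c2 e2 hy]]]] : exists l2 d2 b2, [/\ condition l2 d2 b2,
   extends l1 l2 b1 b2 &
   rk y ∈ rk b \/ rk y = rk b -> exists a, List.In (a, y) l2].
  have [yb|yb] := pselect (rk y ∈ rk b \/ rk y = rk b).
    have [a [l2 [d2 [b2 [c2 e2 ay]]]]] := dense_back c1 xb yb.
    by exists l2, d2, b2; split=> // _; exists a.
  by exists l1, d1, b1; split=> //; split=> //; right.
have [l3 [d3 [b3 [c3 e3 hx]]]] : exists l3 d3 b3, [/\ condition l3 d3 b3,
   extends l2 l3 b2 b3 & Ord x -> (exists p, List.In p l3 /\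
     (rk x ∈ rk p.2 \/ rk x = rk p.2)) \/ b3 ∈ x].
  have [ox|ox] := pselect (Ord x).
    by have [l3 [d3 [b3 [c3 e3 h]]]] := dense_topless c2 ox; exists l3, d3, b3.
  by exists l2, d2, b2; split=> //; split=> //; right.
have [l4 [d4 [b4 [c4 e4 hm]]]] : exists l4 d4 b4, [/\ condition l4 d4 b4,
   extends l3 l4 b3 b4 & outside x -> exists p,
     [/\ List.In p l4, rk p.1 = x & p.1 <> p.2]].
  have [ox|ox] := pselect (outside x).
    by have [l4 [d4 [b4 [c4 e4 h]]]] := dense_move c3 ox; exists l4, d4, b4.
  by exists l3, d3, b3; split=> //; split=> //; right.
have [_ o0 _] := c0; have [_ o1 _] := c1; have [_ o2 _] := c2.
have e24 := extends_trans o2 e3 e4; have e14 := extends_trans o1 e2 e24.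
exists l4, d4, b4; split=> //; first exact: extends_trans o0 e1 e14.
exists b; split=> //.
- exact: e14.1.
- by move=> /hy[a /e24.1 ay]; exists a.
- move=> ox; case: (hx ox) => [[p [/e4.1 pl h]]|bx]; first by left; exists p.
  right; case: e4.2 => [bb|->//]; exact: Ord_trans bb bx.
Qed.

Lemma countable_pairs : countable [set: M] ->
  exists en : nat -> M * M, forall p, exists n, en n = p.
Proof.
move=> /countable_injP[f finj]; have [e _] := someM.
have g_ex n : exists m, forall m', f m' = n -> m = m'.
  have [[m mn]|h] := pselect (exists m, f m = n).
    by exists m => m' m'n; apply: finj; rewrite ?inE // mn m'n.
  by exists (e 0) => m' m'n; case: h; exists m'.
have [g hg] := choice g_ex.
pose en n := if unpickle n is Some (i, j) then (g i, g j) else (e 0, e 0).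
exists en => -[x y]; exists (pickle (f x, f y)).
by rewrite /en pickleK (hg _ x) // (hg _ y).
Qed.

(** The union of a chain of conditions that handles all pairs. *)
Lemma rank_cut_embedding alpha : countable [set: M] -> Ord alpha ->
  exists i : M -> M,
    [/\ rank_cut i,
        forall s : M, S s -> i s = s,
        level alpha `<=` range i &
        forall xi : M, Ord xi -> ~ S xi ->
          exists2 m : M, is_rank m xi & i m <> m].
Proof.
move=> hcount halpha.
have [en henum] := countable_pairs hcount.
have [d0 hd0] := outside_exists.
pose l0 := [:: (alpha, alpha)].
have [beta0 [ob0 hb0]] := start (code1 l0) hd0.
pose state := (seq (M * M) * M * M)%type.
pose valid (c : state) := condition c.1.1 c.1.2 c.2.
pose le (c c' : state) := extends c.1.1 c'.1.1 c.2 c'.2.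
have next_ex (nc : nat * state) : exists c', valid nc.2 ->
    [/\ valid c', le nc.2 c' &
      handled c'.1.1 c'.2 (en nc.1).1 (en nc.1).2].
  have [v|nv] := pselect (valid nc.2); last by exists nc.2.
  have [l [d [b h]]] := dense (en nc.1).1 (en nc.1).2 v.
  by exists (l, d, b).
have [next hnext] := choice next_ex.
pose c := fix c n := if n is k.+1 then next (k, c k) else (l0, d0, beta0).
have cvalid n : valid (c n).
  by elim: n => [|n IH] //=; have [] := hnext (n, c n) IH.
have cS n : le (c n) (c n.+1) by have [] := hnext (n, c n) (cvalid n).
have cle m n : m <= n -> le (c m) (c n).
  elim: n => [|n IH]; first by rewrite leqn0 => /eqP->; split=> //; right.
  rewrite leq_eqVlt => /predU1P[->|mn]; first by split=> //; right.
  have [_ ob _] := cvalid m.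
  exact: extends_trans ob (IH mn) (cS n).
have hand x y : exists n, handled (c n).1.1 (c n).2 x y.
  have [n nE] := henum (x, y); exists n.+1.
  by have [_ _] := hnext (n, c n) (cvalid n); rewrite nE.
pose graph p := exists n, List.In p (c n).1.1.
have graph_alike p q : graph p -> graph q ->
    alike p.1 q.1 p.2 q.2 \/ alike q.1 p.1 q.2 p.2.
  move=> [m pm] [n qn]; apply: (condition_alike (cvalid (maxn m n))).
    exact: (cle _ _ (leq_maxl m n)).1.
  exact: (cle _ _ (leq_maxr m n)).1.
have total x : exists b, graph (x, b).
  by have [n [b [xb _ _ _]]] := hand x x; exists b, n.
have [i hi] := choice total.
have graphE p : graph p -> p.2 = i p.1.
  move=> gp; have := graph_alike _ _ gp (hi p.1).
  by case=> -[_ _ [h _] _]; [|apply/esym]; exact: h.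
have range_V n x : elt (i x) (V (c n).2).
  have [m xm] := hi x.
  have h := condition_range (cvalid (maxn m n))
    ((cle _ _ (leq_maxl m n)).1 _ xm).
  have [_ [bb|<- //]] := cle _ _ (leq_maxr m n).
  exact: V_mono h bb.
have initial m n : rank_le n (i m) -> range i n.
  move=> /(rank_leE) nm; have [k [b [mb hb _ _]]] := hand m n.
  have bE : b = i m by apply: (graphE (m, b)); exists k.
  have [|a an] := hb; first by rewrite bE.
  by exists a => //; apply/esym/(graphE (a, n)); exists k.
exists i; split.
- split.
    split; last by move=> m n; exact: initial.
    split=> [x y E|x y].
      case: (graph_alike _ _ (hi x) (hi y)) => -[_ _ [_ h] _]; first exact: h.
      exact/esym/h.
    by case: (graph_alike _ _ (hi x) (hi y)) => -[].
  split.
    exists (c 0).2; first by have [] := cvalid 0.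
    move=> _ [x _ <-]; apply/(rank_ltE).
    by apply/V_Ord; [have [] := cvalid 0|exact: range_V].
  move=> g og ng; have [n [b [_ _ hg _]]] := hand g g.
  have [[p [pn gp]]|bg] := hg og.
    case: ng; apply: (initial p.1); apply/(rank_leE).
    by rewrite -graphE //; exists n.
  exists (c n).2; have [_ ob _] := cvalid n; split=> //.
  move=> [x _ xb]; have := range_V n x; rewrite xb => /(V_Ord _ ob).
  by rewrite rk_Ord // => /(elt_irrefl).
- move=> s Ss; have [n sn] := hi s.
  exact/esym/(condition_fixes (cvalid n) sn).
- move=> x /(rank_ltE) xa.
  have aE : alpha = i alpha by apply: (graphE (alpha, alpha)); exists 0; left.
  apply: (initial alpha); apply/(rank_leE).
  by rewrite -aE (rk_Ord halpha); left.
- move=> xi oxi nxi; have [n [b [_ _ _ hm]]] := hand xi xi.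
  have [|p [pn <- pp]] := hm; first by split.
  exists p.1; first exact/is_rank_rk.
  by rewrite -graphE; [exact/nesym|exists n].
Qed.

End Cut.

End SetTheory.

Theorem corollary7p12 (M : structure)
  (hM : models M (KPP `|` separation (SigmaP 2) `|` foundation (PiP 2)))
  (hcount : countable [set: M]) (hns : nonstandard M)
  (S : set M) (hS : rank_cut_of S) (alpha : M) (halpha : Ord alpha) :
  exists i : M -> M,
    [/\ rank_cut i,
        forall s : M, S s -> i s = s,
        level alpha `<=` range i &
        forall xi : M, Ord xi -> ~ S xi -> exists2 m : M, is_rank m xi & i m <> m].
Proof.
have inh : inhabited M by exists.
exact: (rank_cut_embedding hM inh hS hcount halpha).
Qed.
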